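(* For $a,b,a',b'\in\mathbb{R}$ put $A(a,b)=[a^2+b^2:a^2-b^2:2ab]$ and $B(a',b')=[a'^2+b'^2:-a'^2+b'^2:-2a'b']$. Assigning to $[(a,a'):(b,b')]\in R(\mathbb{C}_s^2)$ the oriented geodesic of the hyperbolic plane $\mathbb{H}^2_{\mathbb{R}}$ going from $B(a',b')\in\partial\mathbb{H}^2_{\mathbb{R}}$ to $A(a,b)\in\partial\mathbb{H}^2_{\mathbb{R}}$ is a well-defined one-to-one correspondence between $R(\mathbb{C}_s^2)$ and the set of oriented geodesics of $\mathbb{H}^2_{\mathbb{R}}$. Moreover, the map $$f:R(\mathbb{C}_s^2)\to\mathrm{dS}^2,\qquad f([(a,a'):(b,b')])=A(a,b)\times B(a',b')=[ab'-a'b:\ ab'+a'b:\ -aa'+bb'],$$ is a $2$-to-$1$ covering map satisfying $f^*g_{\mathrm{dS}^2}=-4\,g_{\mathbb{P}^1_{\mathbb{C}_s}}$; that is, up to rescaling the metrics, $f$ is an isometric double cover.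
   Context: $\mathbb{C}_s$ denotes the split-complex numbers, identified with the algebra $\mathbb{R}\times\mathbb{R}$ (coordinatewise operations) with involution $(x,y)^*=(y,x)$; real numbers $r$ are identified with $(r,r)$. On $\mathbb{C}_s^2$ take the Hermitian form $\langle u,v\rangle=u_1v_1^*+u_2v_2^*$. A vector $u\in\mathbb{C}_s^2$ is good if $u_1\mathbb{C}_s+u_2\mathbb{C}_s=\mathbb{C}_s$, and $\mathbb{P}^1_{\mathbb{C}_s}$ is the quotient of the set of good vectors by the group of units $\mathbb{C}_s^\times$. The regular region is $R(\mathbb{C}_s^2)=\{[p]\in\mathbb{P}^1_{\mathbb{C}_s}:\langle p,p\rangle\neq0\}$; for $p=((a,a'),(b,b'))$ the condition reads $aa'+bb'\neq0$. The tangent space at a regular point $[p]$ is identified with the $\mathbb{C}_s$-linear maps $\phi:\mathbb{C}_sp\to p^\perp$, $p^\perp=\{v:\langle v,p\rangle=0\}$ ($\phi$ is the velocity at $\epsilon=0$ of $\epsilon\mapsto[p+\epsilon\phi(p)]$), and $g_{\mathbb{P}^1_{\mathbb{C}_s}}(\phi,\psi)=\mathrm{Re}\frac{\langle\phi(p),\psi(p)\rangle}{\langle p,p\rangle}$, where $\mathrm{Re}\,u=(u+u^* )/2$. On $\mathbb{R}^3$ take the Minkowski form $\langle x,y\rangle=-x_1y_1+x_2y_2+x_3y_3$. In $\mathbb{P}^2_{\mathbb{R}}$ put $\mathbb{H}^2_{\mathbb{R}}=\{[p]:\langle p,p\rangle<0\}$, $\partial\mathbb{H}^2_{\mathbb{R}}=\{[p]:\langle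 p,p\rangle=0\}$, $\mathrm{dS}^2=\{[p]:\langle p,p\rangle>0\}$. Tangent vectors at $[p]$ with $\langle p,p\rangle\ne0$ are identified with the $\mathbb{R}$-linear maps $\phi:\mathbb{R}p\to p^\perp$, $p^\perp=\{v\in\mathbb{R}^3:\langle v,p\rangle=0\}$ ($\phi$ is the velocity at $\epsilon=0$ of $\epsilon\mapsto[p+\epsilon\phi(p)]$), and both $\mathbb{H}^2_{\mathbb{R}}$ and $\mathrm{dS}^2$ carry the metric $g(\phi,\psi)=-\frac{\langle\phi(p),\psi(p)\rangle}{\langle p,p\rangle}$; on $\mathrm{dS}^2$ it is denoted $g_{\mathrm{dS}^2}$. The geodesics of $\mathbb{H}^2_{\mathbb{R}}$ are the nonempty intersections of projective lines with $\mathbb{H}^2_{\mathbb{R}}$. The cross product on $\mathbb{R}^3$ is the bilinear antisymmetric product with $e_1\times e_2=e_3$, $e_2\times e_3=-e_1$, $e_3\times e_1=e_2$ (equivalently $\langle u\times v,w\rangle\, e_1\wedge e_2\wedge e_3=u\wedge v\wedge w$); it induces a point $[u\times v]$ of $\mathbb{P}^2_{\mathbb{R}}$ for distinct points $[u],[v]$. *)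

(* Defs.v *)
From HB Require Import structures.
From mathcomp Require Import all_boot all_order all_algebra generic_quotient.
From mathcomp Require Import all_classical all_reals all_analysis.

Set Implicit Arguments.
Unset Strict Implicit.
Unset Printing Implicit Defensive.

Import Order.TTheory GRing.Theory Num.Theory.
Import numFieldNormedType.Exports.

Local Open Scope classical_set_scope.
Local Open Scope ring_scope.
Local Open Scope quotient_scope.

(* Quotients of a set D of vectors of K^n by the group of units of K. *)
Section Projectivization.
Context (K : comUnitRingType) (n : nat) (D : set 'rV[K]_n).

Definition same_point (u v : D) : bool :=
  `[< exists2 c : K, c \is a GRing.unit & \val v = c *: \val u >].

Lemma same_point_refl : reflexive same_point.
Proof. by move=> u; apply/asboolP; exists 1; rewrite ?unitr1 ?scale1r. Qed.

Lemma same_point_sym : symmetric same_point.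
Proof.
suff H u v : same_point u v -> same_point v u.
  by move=> u v; apply/idP/idP; exact: H.
case/asboolP => c cu vE; apply/asboolP.
exists c^-1; first by rewrite unitrV.
by rewrite vE scalerA mulVr // scale1r.
Qed.

Lemma same_point_trans : transitive same_point.
Proof.
move=> v u w /asboolP[c cu vE] /asboolP[d du wE]; apply/asboolP.
by exists (d * c); rewrite ?unitrM ?cu ?du // wE vE scalerA.
Qed.

Canonical same_point_equiv :=
  EquivRel same_point same_point_refl same_point_sym same_point_trans.

Definition proj : Type := {eq_quot same_point_equiv}.

(* x = [v]; in particular, v belongs to D. *)
Definition represents (v : 'rV[K]_n) (x : proj) : Prop :=
  exists2 u : D, \val u = v & \pi_proj u = x.

(* The submodule K p for x = [p]; it does not depend on the representative. *)
Definition line (x : proj) : {pred 'rV[K]_n} :=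
  fun v => `[< exists c : K, v = c *: \val (repr x) >].

Lemma line_submod x : submod_closed (line x).
Proof.
split; first by apply/asboolP; exists 0; rewrite scale0r.
move=> a u v /asboolP[c ->] /asboolP[d ->]; apply/asboolP.
by exists (a * c + d); rewrite scalerDl scalerA.
Qed.
HB.instance Definition _ x :=
  GRing.isSubmodClosed.Build K 'rV[K]_n (line x) (line_submod x).

Record line_type (x : proj) := LinePoint {
  line_val :> 'rV[K]_n;
  line_valP : line_val \in line x }.
HB.instance Definition _ x := [isSub for @line_val x].
HB.instance Definition _ x := [Choice of line_type x by <:].
HB.instance Definition _ x := [SubChoice_isSubLmodule of line_type x by <:].

Variable form : 'rV[K]_n -> 'rV[K]_n -> K.

(* The K-linear maps from K p to the orthogonal of p, for x = [p]. *)
Record tangent (x : proj) := Tangent {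
  tangent_fun :> {linear line_type x -> 'rV[K]_n};
  tangent_perp : forall p q : line_type x, form (tangent_fun p) q = 0 }.

(* Let gamma be a lift of the curve c, with c 0 = [p] and gamma 0 = p. The       *)
(* velocity of c at 0 is the map sending p to the component of gamma' 0 in the   *)
(* orthogonal of p along K p; so [p + e phi(p)] has velocity phi. The relation   *)
(* der gamma v says that gamma has derivative v at 0.                            *)
Definition velocity (R : realType) (der : (R -> 'rV[K]_n) -> 'rV[K]_n -> Prop)
    (c : R -> proj) (x : proj) (phi : tangent x) : Prop :=
  c 0 = x /\
  exists (gamma : R -> 'rV[K]_n) (v : 'rV[K]_n) (p : line_type x),
    [/\ gamma 0 = p :> 'rV[K]_n, (\forall e \near (0 : R), represents (gamma e) (c e)),
        der gamma v & v - phi p \in line x].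

End Projectivization.

Section SplitComplexLine.
Context {R : realType}.

(* Split-complex numbers: the product ring R * R. *)
Local Notation Cs := (R * R)%type.

Definition conjs (z : Cs) : Cs := (z.2, z.1).

(* (z + conjs z) / 2 is the pair (Res z, Res z), that is, the real Res z. *)
Definition Res (z : Cs) : R := (z.1 + z.2) / 2.

Definition herm (u v : 'rV[Cs]_2) : Cs :=
  u 0 0 * conjs (v 0 0) + u 0 1 * conjs (v 0 1).

Definition good : set 'rV[Cs]_2 :=
  [set u | forall z : Cs, exists c d : Cs, z = u 0 0 * c + u 0 1 * d].

Definition P1 : Type := proj good.
HB.instance Definition _ :=
  Topological.copy P1 (quotient_topology (proj good : quotType _)).
HB.instance Definition _ := Quotient.on P1.

Definition regular : set P1 :=
  [set x | exists2 p, represents p x & herm p p != 0].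

Definition T1 (x : P1) : Type := tangent herm x.

Definition gP1 (x : P1) (p : line_type x) (phi psi : T1 x) : R :=
  Res (herm (phi p) (psi p) / herm p p).

Definition velocity1 (c : R -> P1) (x : P1) (phi : T1 x) : Prop :=
  velocity (fun (gamma : R -> 'rV[Cs]_2) v =>
      forall i, is_derive (0 : R) (1 : R) (fun e => gamma e 0 i : Cs) (v 0 i))
    c phi.

End SplitComplexLine.

Arguments P1 R : clear implicits.
Arguments good R : clear implicits.
Arguments regular R : clear implicits.

Section RealProjectivePlane.
Context {R : realType}.

Definition vec3 (x y z : R) : 'rV[R]_3 := \row_(i < 3) [:: x; y; z]`_i.

Definition mink (u v : 'rV[R]_3) : R :=
  - (u 0 0 * v 0 0) + u 0 1 * v 0 1 + u 0 2 * v 0 2.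

Definition cross (u v : 'rV[R]_3) : 'rV[R]_3 :=
  vec3 (- (u 0 1 * v 0 2 - u 0 2 * v 0 1))
       (u 0 2 * v 0 0 - u 0 0 * v 0 2)
       (u 0 0 * v 0 1 - u 0 1 * v 0 0).

Definition nonzero : set 'rV[R]_3 := [set u | u != 0].

Definition P2 : Type := proj nonzero.
HB.instance Definition _ :=
  Topological.copy P2 (quotient_topology (proj nonzero : quotType _)).
HB.instance Definition _ := Quotient.on P2.

Definition H2 : set P2 := [set x | exists2 p, represents p x & mink p p < 0].
Definition bdH2 : set P2 := [set x | exists2 p, represents p x & mink p p = 0].
Definition dS2 : set P2 := [set x | exists2 p, represents p x & mink p p > 0].

Definition T2 (x : P2) : Type := tangent mink x.

Definition gdS2 (x : P2) (p : line_type x) (phi psi : T2 x) : R :=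
  - (mink (phi p) (psi p) / mink p p).

Definition velocity2 (c : R -> P2) (x : P2) (phi : T2 x) : Prop :=
  velocity (fun (gamma : R -> 'rV[R]_3) v => is_derive (0 : R) (1 : R) gamma v)
    c phi.

Definition projective_line (W : {vspace 'rV[R]_3}) : set P2 :=
  [set x | exists2 v, represents v x & v \in W].

Definition geodesic (g : set P2) : Prop :=
  g !=set0 /\
  exists2 W : {vspace 'rV[R]_3}, \dim W = 2 & g = projective_line W `&` H2.

(* h parametrizes the curve g, and lt is the order in which h runs through g. *)
Definition parametrizes (g : set P2) (lt : P2 -> P2 -> Prop) (h : R -> P2) :=
  [/\ continuous h, injective h, range h = g &
      forall x y, lt x y <-> exists s t : R, [/\ s < t, h s = x & h t = y]].

(* An orientation of a geodesic is recorded by the order in which its points     *)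
(* are met; parametrizations with the same orientation induce the same order.    *)
Record oriented_geodesic := OrientedGeodesic {
  og_points : set P2;
  og_lt : P2 -> P2 -> Prop;
  og_geodesic : geodesic og_points;
  og_oriented : exists h, parametrizes og_points og_lt h }.

Definition goes_from_to (g : oriented_geodesic) (x y : P2) : Prop :=
  exists2 h : R -> P2, parametrizes (og_points g) (og_lt g) h &
    h t @[t --> -oo] --> x /\ h t @[t --> +oo] --> y.

End RealProjectivePlane.

Arguments P2 R : clear implicits.
Arguments dS2 R : clear implicits.
Arguments oriented_geodesic R : clear implicits.

Section Covering.
Context {X Y : topologicalType}.

Definition homeomorphic_on (A : set X) (B : set Y) (f : X -> Y) : Prop :=
  set_bij A B f /\
  exists g : Y -> X, [/\ forall x, A x -> g (f x) = x,
    {within A, continuous f} & {within B, continuous g}].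

Definition evenly_covered (f : X -> Y) (U : set Y) : Prop :=
  exists (I : Type) (V : I -> set X),
    [/\ forall i, open (V i), trivIset setT V, f @^-1` U = \bigcup_i V i &
        forall i, homeomorphic_on (V i) U f].

Definition covering_map (f : X -> Y) : Prop :=
  continuous f /\ forall y, exists U, [/\ open U, U y & evenly_covered f U].

Definition two_to_one (f : X -> Y) : Prop :=
  forall y, (f @^-1` [set y] #= `I_2)%card.

End Covering.

Section TheMap.
Context {R : realType}.
Implicit Types p : 'rV[(R * R)%type]_2.

(* For p = ((a, a'), (b, b')). *)
Definition endA p : 'rV[R]_3 :=
  let a := (p 0 0).1 in let b := (p 0 1).1 in
  vec3 (a ^+ 2 + b ^+ 2) (a ^+ 2 - b ^+ 2) (2 * a * b).

Definition endB p : 'rV[R]_3 :=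
  let a' := (p 0 0).2 in let b' := (p 0 1).2 in
  vec3 (a' ^+ 2 + b' ^+ 2) (- a' ^+ 2 + b' ^+ 2) (- (2 * a' * b')).

Definition liftf p : 'rV[R]_3 :=
  let a := (p 0 0).1 in let a' := (p 0 0).2 in
  let b := (p 0 1).1 in let b' := (p 0 1).2 in
  vec3 (a * b' - a' * b) (a * b' + a' * b) (- (a * a') + b * b').

(* df is the differential of f at x: it is R-linear and sends the velocity of    *)
(* any curve through x to the velocity of its image.                             *)
Definition is_differential (f : regular R -> dS2 R) (x : regular R)
    (df : T1 (\val x) -> T2 (\val (f x))) : Prop :=
  (forall (r : R) (phi psi chi : T1 (\val x)),
     (forall u, chi u = ((r, r) : R * R) *: phi u + psi u) ->
     forall v, df chi v = r *: df phi v + df psi v) /\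
  (forall (c : R -> regular R) (phi : T1 (\val x)),
     velocity1 (fun e => \val (c e)) phi ->
     velocity2 (fun e => \val (f (c e))) (df phi)).

End TheMap.

(* Main.v *)
Require Import Defs.
From HB Require Import structures.
From mathcomp Require Import all_boot all_order all_algebra generic_quotient.
From mathcomp Require Import all_classical all_reals all_analysis.
From mathcomp Require Import ring lra.
Set Implicit Arguments.
Unset Strict Implicit.
Unset Printing Implicit Defensive.
Import Order.TTheory GRing.Theory Num.Theory.
Import numFieldNormedType.Exports.
Local Open Scope classical_set_scope.
Local Open Scope ring_scope.

(** Write h = a a' + b b' for p = ((a, a'), (b, b')); both components of <p, p>
    equal h. The vectors A = endA p and B = endB p are null, and
    <A, B> = - 2 h^2, so p is regular exactly when the boundary points [A] and
    [B] are distinct.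

    The geodesics. If A and B are null and <A, B> < 0, then
    t |-> [e^t A + e^-t B] runs through the geodesic in the plane spanned by A
    and B, from [B] to [A]. A two-dimensional plane containing a timelike vector is
    spanned by such a pair (lorentzian_plane). Any parametrization of this geodesic
    becomes, after composition with the inverse of this one, a continuous
    injection of the real line into itself, hence a monotone function; so a
    geodesic has just two orientations (oriented_geod_unique). Two
    parametrizations with the same order differ by an increasing bijection, so
    the order determines both ends (endpoints_unique). Hence an oriented
    geodesic amounts to an ordered pair of distinct null lines (goes_from_toP).
    Null lines are the points [a^2 + b^2 : a^2 - b^2 : 2 a b] of a conic, for
    a unique [a : b] (null_vector_veronese, veronese_inj), and this makes
    [p] |-> ([A], [B]) a bijection.

    The double cover. One has A x B = 2 h n with n = liftf p, and
    <n, n> = h^2. The entries of the rank one matrix (a, b)^T (a', b') are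
    linear in n and h, so the line of (n, h) determines [p]
    (liftf_hdot_inj). Given [n] in dS2 only the sign of h relative to n is
    free: changing it exchanges A and B, and each fiber has two points. Over
    the open set where <n, m> <> 0 the sign of h <n, m> separates two sheets,
    and h = +- sqrt <n, n> followed by reading off a column and a row of the
    rank one matrix is a continuous inverse on each sheet
    (local_inverse_cvg).

    The metrics. A vector u orthogonal to p has the form
    ((- l b', - l' b), (l a', l' a)), and the derivative of liftf at p along u
    is l' A - l B. As A and B are null, its products involve <A, B> = - 2 h^2
    only, whence the factor - 4 (mink_dliftf). *)

(** * Projective points and their representatives *)
Section ProjectivePoints.
Local Open Scope quotient_scope.
Context (K : comUnitRingType) (n : nat) (D : set 'rV[K]_n).
Implicit Types (u v : 'rV[K]_n) (x y : Defs.proj D).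

Lemma represents_repr x : represents (\val (repr x)) x.
Proof. by exists (repr x) => //; rewrite reprK. Qed.

Lemma represents_in u x : represents u x -> D u.
Proof. by move=> [w <- _]; exact: set_valP. Qed.

Lemma represents_ratio u v x : represents u x -> represents v x ->
  exists2 c : K, c \is a GRing.unit & v = c *: u.
Proof.
move=> [u' <- <-] [v' <- /eqmodP/=]; rewrite same_point_sym.
by move=> /asboolP.
Qed.

Lemma represents_inj u x y : represents u x -> represents u y -> x = y.
Proof. by move=> [u' <- <-] [v' /val_inj-> <-]. Qed.

Lemma represents_scale u x c : c \is a GRing.unit -> D (c *: u) ->
  represents u x -> represents (c *: u) x.
Proof.
move=> cu Dcu [u' uE <-]; exists (SigSub (mem_set Dcu)) => //.
apply/eqmodP; rewrite /= same_point_sym; apply/asboolP; exists c => //.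
by rewrite /= uE.
Qed.

Lemma represents_ex u : D u -> exists x, represents u x.
Proof.
move=> Du; exists (\pi_(Defs.proj D) (SigSub (mem_set Du))).
by exists (SigSub (mem_set Du)).
Qed.

Definition point_at u (Du : D u) : Defs.proj D :=
  \pi_(Defs.proj D) (SigSub (mem_set Du)).

Lemma point_atP u (Du : D u) : represents u (point_at Du).
Proof. by exists (SigSub (mem_set Du)). Qed.

Lemma lineP x u v : represents u x -> v \in line x <-> exists c : K, v = c *: u.
Proof.
move=> ux; have [c cu xE] := represents_ratio ux (represents_repr x).
split=> [/asboolP[d ->]|[d ->]]; first by exists (d * c); rewrite xE scalerA.
by apply/asboolP; exists (d / c); rewrite xE scalerA divrK.
Qed.

Lemma represents_line x u : represents u x -> u \in line x.
Proof. by move=> ux; apply/(lineP _ ux); exists 1; rewrite scale1r. Qed.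

End ProjectivePoints.

(** * Quotient topologies of the two projective spaces *)
Section OpenQuotient.
Local Open Scope quotient_scope.
Context (T : topologicalType) (Q0 : quotType T).
Local Notation Q := (quotient_topology Q0).

(** When the classes are the orbits of a family of continuous maps, the
    saturation of an open set V is the union of the preimages of V, hence open;
    the projection is then open and neighborhoods can be computed upstairs. *)
Lemma nbhs_quotient_by_maps (I : Type) (s : I -> T -> T) (u : T) (N : set Q) :
  (forall i, continuous (s i)) -> (forall i v, \pi_Q (s i v) = \pi_Q v) ->
  (forall v w, \pi_Q v = \pi_Q w -> exists i, w = s i v) ->
  nbhs (\pi_Q u) N <-> nbhs u (\pi_Q @^-1` N).
Proof.
move=> sC spi pis; split=> [|]; first exact: pi_continuous.
rewrite !nbhsE => -[V [oV Vu] VN]; exists (\pi_Q @` V).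
  split; last by exists u.
  suff E : \pi_Q @^-1` (\pi_Q @` V) = \bigcup_i (s i @^-1` V).
    rewrite /open/= /quotient_open E; apply: bigcup_open => i _.
    by apply: open_comp oV => w _; exact: sC.
  apply/seteqP; split=> [w [v Vv vw]|w [i _ Viw]]; last by exists (s i w).
  by have [i viw] := pis _ _ (esym vw); exists i => //=; rewrite -viw.
by move=> _ [v Vv <-]; exact: VN.
Qed.
End OpenQuotient.

Lemma nbhs_set_type (X : topologicalType) (A : set X) (x : A) (N : set A) :
  nbhs x N <-> nbhs (\val x) [set y | forall z : A, \val z = y -> N z].
Proof.
split; rewrite !nbhsE.
  move=> [_ [[V oV <-] Vx] VN].
  by exists V => // y Vy z zy; apply: VN; move: Vy; rewrite -zy.
move=> [V [oV Vx] VN].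
exists (\val @^-1` V); first by split => //; exists V.
by move=> z Vz; exact: VN Vz _ _.
Qed.

Section RowVectors.
Context (T : topologicalType) (n : nat).

Lemma cvg_rV (U : Type) (F : set_system U) (h : U -> 'rV[T]_n) (v : 'rV[T]_n) :
  Filter F -> (forall i, (fun t => h t 0 i) @ F --> v 0 i) -> h @ F --> v.
Proof.
move=> FF hv N [P Pv PN].
have : \forall t \near F, forall i, P 0 i (h t 0 i).
  apply: filter_forall => i; apply: (hv i); exact: Pv.
by apply: filterS => t Pt; apply: PN => i j; rewrite ord1.
Qed.

Lemma coord_rV_continuous i : continuous (fun v : 'rV[T]_n => v 0 i).
Proof.
move=> v N Nv; exists (fun _ j => if j == i then N else setT).
  by move=> a j; case: eqP => [->|_]; [rewrite ord1|exact: filterT].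
by move=> w /(_ 0 i); rewrite eqxx.
Qed.
End RowVectors.

Lemma cvg_coord_rV (T : topologicalType) (n : nat) (U : Type) (F : set_system U)
    (h : U -> 'rV[T]_n) (v : 'rV[T]_n) i :
  h @ F --> v -> h t 0 i @[t --> F] --> v 0 i.
Proof.
move=> hv N Nv; apply: (hv [set w : 'rV[T]_n | N (w 0 i)]).
exact: (@coord_rV_continuous T n i v N Nv).
Qed.

Section UnitScaling.
Local Open Scope quotient_scope.
Context (K : comUnitRingType) (n : nat) (D : set 'rV[K]_n).
Hypothesis Dscale : forall (c : K) u, c \is a GRing.unit -> D u -> D (c *: u).

Definition unit_scale (c : {c : K | c \is a GRing.unit}) (v : D) : D :=
  SigSub (mem_set (Dscale (svalP c) (set_valP v))).

Lemma pi_unit_scale c v :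
  \pi_(Defs.proj D) (unit_scale c v) = \pi_(Defs.proj D) v.
Proof.
apply/eqmodP; rewrite /= same_point_sym; apply/asboolP; exists (sval c) => //.
exact: (svalP c).
Qed.

Lemma pi_eq_unit_scale v w :
  \pi_(Defs.proj D) v = \pi_(Defs.proj D) w -> exists c, w = unit_scale c v.
Proof.
move=> /eqmodP/= /asboolP[c cu wE]; exists (exist _ c cu).
exact: val_inj.
Qed.
End UnitScaling.

Section Topology.
Context {R : realType}.
Local Notation Cs := (R * R)%type.

Lemma nonzero_scale (c : R) u :
  c \is a GRing.unit -> nonzero u -> nonzero (c *: u).
Proof.
by rewrite unitfE /nonzero/= => c0 u0; rewrite scaler_eq0 negb_or c0.
Qed.

Lemma good_scale (c : Cs) u : c \is a GRing.unit -> good R u -> good R (c *: u).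
Proof.
move=> cu gu z; have [d [e zE]] := gu z; exists (c^-1 * d), (c^-1 * e).
by rewrite zE !mxE; congr (_ + _); rewrite mulrACA mulrV // mul1r.
Qed.

Lemma mulCs_continuous (c : Cs) : continuous (fun z : Cs => c * z).
Proof.
move=> z; apply: (@cvg_pair _ _ _ _ (nbhs (c.1 * z.1)) (nbhs (c.2 * z.2))).
  by apply: cvgM; [exact: cvg_cst|exact: cvg_fst].
by apply: cvgM; [exact: cvg_cst|exact: cvg_snd].
Qed.

Lemma continuous_set_type (X Y : topologicalType) (A : set X) (B : set Y)
    (h : X -> Y) (k : A -> B) :
  continuous h -> (forall x, \val (k x) = h (\val x)) -> continuous k.
Proof.
move=> hC kh x N /nbhs_set_type; rewrite kh => /hC hN.
apply: (nbhs_set_type x (k @^-1` N)).2.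
have := hN : nbhs (\val x) (h @^-1` _).
by apply: filterS => y hy z zy; apply: hy; rewrite kh zy.
Qed.

(** Reduces every continuity question on the projective plane to one about
    representing vectors near a chosen representative. *)
Lemma nbhs_P2 u (x : P2 R) (N : set (P2 R)) : represents u x ->
  nbhs x N <-> nbhs u [set v | forall y : P2 R, represents v y -> N y].
Proof.
move=> [u' <- <-].
have E := @nbhs_quotient_by_maps _ (Defs.proj (@nonzero R) : quotType _) _
  (unit_scale nonzero_scale) u' N _ (pi_unit_scale nonzero_scale)
  (@pi_eq_unit_scale _ _ _ nonzero_scale).
apply: iff_trans (E _) _.
  move=> c; apply: (@continuous_set_type 'rV[R]_3 'rV[R]_3 _ _
    (fun v => sval c *: v)) => //.
  move=> v; apply: (@cvg_rV _ _ _ (nbhs v)) => i.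
  under [X in X @ _]eq_fun do rewrite mxE.
  rewrite mxE; apply: cvgM; [exact: cvg_cst|exact: coord_rV_continuous].
apply: iff_trans (nbhs_set_type _ _) _.
split; apply: filterS => v vN.
  by move=> y [v' vv' <-]; apply: vN.
by move=> z zv; apply: vN; exists z.
Qed.

Lemma nbhs_P1 u (x : P1 R) (N : set (P1 R)) : represents u x ->
  nbhs x N <-> nbhs u [set v | forall y : P1 R, represents v y -> N y].
Proof.
move=> [u' <- <-].
have E := @nbhs_quotient_by_maps _ (Defs.proj (good R) : quotType _) _
  (unit_scale good_scale) u' N _ (pi_unit_scale good_scale)
  (@pi_eq_unit_scale _ _ _ good_scale).
apply: iff_trans (E _) _.
  move=> c; apply: (@continuous_set_type 'rV[Cs]_2 'rV[Cs]_2 _ _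
    (fun v => sval c *: v)) => //.
  move=> v; apply: (@cvg_rV _ _ _ (nbhs v)) => i.
  under [X in X @ _]eq_fun do rewrite mxE.
  rewrite mxE.
  apply: (@continuous_comp _ _ _ (fun v : 'rV[Cs]_2 => v 0 i)).
    exact: coord_rV_continuous.
  exact: mulCs_continuous.
apply: iff_trans (nbhs_set_type _ _) _.
split; apply: filterS => v vN.
  by move=> y [v' vv' <-]; apply: vN.
by move=> z zv; apply: vN; exists z.
Qed.

(** Convergence may be checked on lifts: the canonical representatives
    themselves need not depend continuously on the point. *)
Lemma cvg_P2 (U : Type) (F : set_system U) (h : U -> 'rV[R]_3) (c : U -> P2 R)
    (u : 'rV[R]_3) (x : P2 R) : Filter F -> represents u x -> h @ F --> u ->
  (\forall t \near F, represents (h t) (c t)) -> c @ F --> x.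
Proof.
move=> FF ux hu hc N /(nbhs_P2 _ ux) /hu hN.
have {}hN : F (h @^-1` [set v | forall y : P2 R, represents v y -> N y]) := hN.
have := @filterI _ F FF _ _ hN hc.
by apply: (@filterS _ F FF) => t [/= + ht]; apply.
Qed.

End Topology.

(** * Minkowski space and the separation of points of the projective plane *)
Section MinkowskiSpace.
Context {R : realType}.
Implicit Types (u v w : 'rV[R]_3) (a b c d : R).

Lemma vec3E (a b c : R) : ((vec3 a b c 0 0 = a) * (vec3 a b c 0 1 = b) *
  (vec3 a b c 0 2 = c))%type.
Proof. by rewrite !mxE. Qed.

Lemma row3P u v : u 0 0 = v 0 0 -> u 0 1 = v 0 1 -> u 0 2 = v 0 2 -> u = v.
Proof.
move=> e0 e1 e2; apply/rowP => -[[|[|[|//]]] i].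
- by have -> : Ordinal i = 0 by exact: val_inj.
- by have -> : Ordinal i = 1 by exact: val_inj.
- by have -> : Ordinal i = 2 by exact: val_inj.
Qed.

Lemma minkC u v : mink u v = mink v u.
Proof. by rewrite /mink; ring. Qed.

Lemma minkDl u v w : mink (u + v) w = mink u w + mink v w.
Proof. by rewrite /mink !mxE; ring. Qed.

Lemma minkZl a u w : mink (a *: u) w = a * mink u w.
Proof. by rewrite /mink !mxE; ring. Qed.

Lemma minkBl u v w : mink (u - v) w = mink u w - mink v w.
Proof. by rewrite /mink !mxE; ring. Qed.

Lemma minkDr u v w : mink w (u + v) = mink w u + mink w v.
Proof. by rewrite /mink !mxE; ring. Qed.

Lemma minkZr a u w : mink w (a *: u) = a * mink w u.
Proof. by rewrite /mink !mxE; ring. Qed.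

Lemma minkBr u v w : mink w (u - v) = mink w u - mink w v.
Proof. by rewrite /mink !mxE; ring. Qed.

Definition minkE := (minkBl, minkBr, minkDl, minkDr, minkZl, minkZr).

Lemma mink_cvg2 (U : Type) (F : set_system U) (h k : U -> 'rV[R]_3) u w :
  Filter F -> h @ F --> u -> k @ F --> w ->
  mink (h t) (k t) @[t --> F] --> mink u w.
Proof.
move=> FF hu kw.
have hi i : h t 0 i @[t --> F] --> u 0 i by exact: cvg_coord_rV.
have ki i : k t 0 i @[t --> F] --> w 0 i by exact: cvg_coord_rV.
by apply: cvgD; [apply: cvgD; [apply: cvgN|]|]; exact: cvgM.
Qed.

Lemma mink_cvg (U : Type) (F : set_system U) (h : U -> 'rV[R]_3) u w :
  Filter F -> h @ F --> u -> mink (h t) w @[t --> F] --> mink u w.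
Proof. by move=> FF hu; apply: mink_cvg2 => //; exact: cvg_cst. Qed.

Lemma mink_continuous w : continuous (mink ^~ w).
Proof.
by move=> u; apply: (@mink_cvg _ (nbhs u) idfun u w) => N Nu; exact: Nu.
Qed.

(** Reversed Cauchy-Schwarz: the orthogonal of a timelike vector is
    positive definite. *)
Lemma mink_orth_gt0 v w : mink v v < 0 -> mink w v = 0 -> w != 0 ->
  0 < mink w w.
Proof.
rewrite /mink => vv wv w0.
set v0 := v 0 0 in vv wv *; set v1 := v 0 1 in vv wv *.
set v2 := v 0 2 in vv wv *; set x := w 0 0 in wv *.
set y := w 0 1 in wv *; set z := w 0 2 in wv *.
have v0n : 0 < v0 ^+ 2 by nra.
have [yz0|yzn0] := eqVneq (y ^+ 2 + z ^+ 2) 0.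
  have y0 : y = 0 by nra.
  have z0 : z = 0 by nra.
  have x0 : x = 0.
    apply/eqP; rewrite -(mulIr_eq0 _ (mulIf _ : injective (fun t => t * v0))).
      by apply/eqP; rewrite y0 z0 in wv; lra.
    by apply: contraTneq v0n => ->; rewrite expr0n ltxx.
  case/eqP: w0; apply: row3P; rewrite !mxE //.
have yzp : 0 < y ^+ 2 + z ^+ 2 by rewrite lt_def yzn0 addr_ge0 ?sqr_ge0.
rewrite -(pmulr_rgt0 _ v0n).
have xv : x * v0 = y * v1 + z * v2 by lra.
have -> : v0 ^+ 2 * (- (x * x) + y * y + z * z) =
  (y ^+ 2 + z ^+ 2) * (v0 ^+ 2 - v1 ^+ 2 - v2 ^+ 2) +
  (y * v2 - z * v1) ^+ 2 + ((y * v1 + z * v2) ^+ 2 - (x * v0) ^+ 2) by ring.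
rewrite xv subrr addr0 ltr_wpDr ?sqr_ge0 // mulr_gt0 //; lra.
Qed.

Lemma mink_div_cvg (U : Type) (F : set_system U) (h : U -> 'rV[R]_3) u v w :
  Filter F -> h @ F --> u -> mink u w != 0 ->
  mink (h t) v / mink (h t) w @[t --> F] --> mink u v / mink u w.
Proof.
move=> FF hu uw; apply: cvgM; first exact: mink_cvg.
by apply: cvgV => //; exact: mink_cvg.
Qed.

Lemma nonzero_mink u w : mink u w != 0 -> nonzero u.
Proof.
by move=> uw; rewrite /nonzero/=; apply: contraNneq uw => ->; apply/eqP;
  rewrite /mink !mxE; ring.
Qed.

Lemma represents_scaleR u (x : P2 R) c : c != 0 ->
  represents u x -> represents (c *: u) x.
Proof.
move=> c0 ux; have cu : c \is a GRing.unit by rewrite unitfE.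
apply: represents_scale => //.
exact: nonzero_scale cu (represents_in ux).
Qed.

(** Numerator and denominator scale alike, so this is a function on the
    projective plane, continuous where the denominator does not vanish; such
    functions serve as affine coordinates. *)
Definition mink_ratio v w (x : P2 R) : R :=
  mink (\val (repr x)) v / mink (\val (repr x)) w.

Lemma mink_ratioE v w u (x : P2 R) : represents u x ->
  mink_ratio v w x = mink u v / mink u w.
Proof.
move=> ux; have [c] := represents_ratio ux (represents_repr x).
rewrite unitfE /mink_ratio => c0 ->; rewrite !minkE.
by rewrite invfM mulrACA divff // mul1r.
Qed.

Lemma mink_ratio_cvg v w u (x : P2 R) : represents u x -> mink u w != 0 ->
  mink_ratio v w y @[y --> x] --> mink_ratio v w x.
Proof.
move=> ux uw; rewrite (mink_ratioE _ _ ux) => N Nu.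
apply: (nbhs_P2 (mink_ratio v w @^-1` N) ux).2.
have := @mink_div_cvg _ (nbhs u) idfun u v w _ (fun N Nu => Nu) uw.
move=> /(_ _ N Nu) h.
have {}h : nbhs u [set t | N (mink t v / mink t w)] := h.
by apply: filterS h => t Nt y ty; rewrite /= (mink_ratioE _ _ ty).
Qed.

Lemma mink_ratio_cvg_comp (U : Type) (F : set_system U) (h : U -> P2 R) v w u
    (x : P2 R) : h @ F --> x -> represents u x -> mink u w != 0 ->
  mink_ratio v w (h t) @[t --> F] --> mink_ratio v w x.
Proof.
move=> hx ux uw N Nx.
have A : nbhs x (mink_ratio v w @^-1` N) := mink_ratio_cvg ux uw Nx.
exact: hx A.
Qed.

Lemma mink_nondeg u v : (forall w, mink u w = mink v w) -> u = v.
Proof.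
move=> uv; apply: row3P.
- by have := uv (vec3 1 0 0); rewrite /mink !vec3E; lra.
- by have := uv (vec3 0 1 0); rewrite /mink !vec3E; lra.
- by have := uv (vec3 0 0 1); rewrite /mink !vec3E; lra.
Qed.

Lemma mink_separating u v : u != 0 -> v != 0 ->
  exists w, mink u w != 0 /\ mink v w != 0.
Proof.
have ex (t : 'rV[R]_3) : t != 0 -> exists w, mink t w != 0.
  move=> t0; apply: contrapT => /forallNP h; case/eqP: t0.
  apply: mink_nondeg => w; have /negP := h w; rewrite negbK => /eqP ->.
  by rewrite /mink !mxE; ring.
move=> /ex[w uw] /ex[w' vw'].
have [vw|] := eqVneq (mink v w) 0; last by exists w.
have [uw'|] := eqVneq (mink u w') 0; last by exists w'.
by exists (w + w'); rewrite !minkE vw uw' addr0 add0r.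
Qed.

(** The plane is Hausdorff: some w is orthogonal to neither of two given
    points, and the coordinates with denominator <., w> recover both from the
    limit. *)
Lemma P2_cvg_unique (U : Type) (F : set_system U) (h : U -> P2 R) (x y : P2 R) :
  ProperFilter F -> h @ F --> x -> h @ F --> y -> x = y.
Proof.
move=> FF hx hy.
have ux := represents_repr x; have vy := represents_repr y.
set u := \val (repr x) in ux; set v := \val (repr y) in vy.
have [w [uw vw]] := mink_separating (represents_in ux) (represents_in vy).
have E t : mink u t / mink u w = mink v t / mink v w.
  rewrite -(mink_ratioE _ _ ux) -(mink_ratioE _ _ vy).
  apply: (cvg_unique (@norm_hausdorff _ R) (F := mink_ratio t w \o h @ F)).
    exact: (mink_ratio_cvg_comp hx ux).
  exact: (mink_ratio_cvg_comp hy vy).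
have vE : v = (mink v w / mink u w) *: u.
  apply: mink_nondeg => t; rewrite minkZl -[mink v w / _]mulrC -mulrA.
  rewrite [mink v w * _]mulrC mulrA [_^-1 * _]mulrC E.
  by rewrite divfK.
apply: represents_inj vy; rewrite vE; apply: represents_scaleR => //.
by rewrite mulf_neq0 ?invr_eq0.
Qed.

(** * Oriented geodesics and their ends *)
Lemma oriented_geodesic_eq (g g' : oriented_geodesic R) :
  og_points g = og_points g' -> (forall x y, og_lt g x y <-> og_lt g' x y) ->
  g = g'.
Proof.
case: g g' => [P lt gP gO] [P' lt' gP' gO'] /= PP' ltE.
have E : lt = lt' by apply/funext => x; apply/funext => y; apply/propext.
subst P' lt'; congr OrientedGeodesic; exact: Prop_irrelevance.
Qed.

Lemma continuous_injective_monotone (phi : R -> R) :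
  continuous phi -> injective phi ->
  {mono phi : s t / s < t} \/ {mono phi : s t /~ s < t}.
Proof.
move=> phiC phiI.
have : {in `]-oo, +oo[ &, injective phi} by move=> s t _ _; exact: phiI.
have /itv_continuous_inj_mono /[apply] :
    {within [set` `]-oo, +oo[], continuous phi}.
  exact: continuous_subspaceT.
case=> phiM.
- left=> s t; case: (ltgtP s t) => [st|ts|->]; last by rewrite ltxx.
  + by rewrite phiM // in_itv.
  + by apply/negbTE; rewrite -leNgt ltW // phiM // in_itv.
- right=> s t; case: (ltgtP t s) => [ts|st|->]; last by rewrite ltxx.
  + by rewrite phiM // in_itv.
  + by apply/negbTE; rewrite -leNgt ltW // phiM // in_itv.
Qed.

(** The sign condition makes the combinations of A and B with positive
    coefficients timelike. *)
Definition null_pair (A B : 'rV[R]_3) : Prop :=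
  [/\ mink A A = 0, mink B B = 0 & mink A B < 0].

Lemma null_pair_sym A B : null_pair A B -> null_pair B A.
Proof. by case=> AA BB AB; split=> //; rewrite minkC. Qed.

Lemma null_pair_nonzero A B : null_pair A B -> nonzero A.
Proof. by case=> _ _ /ltr0_neq0; exact: nonzero_mink. Qed.

Section NullPair.
Variables A B : 'rV[R]_3.
Hypothesis nullAB : null_pair A B.

Let AA : mink A A = 0. Proof. by case: nullAB. Qed.
Let BB : mink B B = 0. Proof. by case: nullAB. Qed.
Let AB : mink A B < 0. Proof. by case: nullAB. Qed.

Local Lemma exp_neq0 (t : R) : expR t != 0.
Proof. by rewrite lt0r_neq0 ?expR_gt0. Qed.

Definition hline t := expR t *: A + expR (- t) *: B.

Lemma mink_hlineA t : mink (hline t) A = expR (- t) * mink A B.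
Proof. by rewrite !minkE AA mulr0 add0r minkC. Qed.

Lemma mink_hlineB t : mink (hline t) B = expR t * mink A B.
Proof. by rewrite !minkE BB mulr0 addr0. Qed.

Lemma hline_nonzero t : nonzero (hline t).
Proof.
apply: (@nonzero_mink _ A).
by rewrite mink_hlineA mulf_neq0 ?exp_neq0 // ltr0_neq0.
Qed.

Definition geod t : P2 R := point_at (hline_nonzero t).

Lemma geodP t : represents (hline t) (geod t).
Proof. exact: point_atP. Qed.

(** Dividing c A + d B by a square root of c d normalizes the coefficients to
    e^t and e^-t with e^(2 t) = c / d. *)
Lemma range_geodP x : range geod x <->
  exists c d, 0 < c * d /\ represents (c *: A + d *: B) x.
Proof.
split=> [[t _ <-]|[c [d [cd vx]]]].
  exists (expR t), (expR (- t)); split; last exact: geodP.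
  by rewrite mulr_gt0 ?expR_gt0.
have c0 : c != 0 by apply: contraTneq cd => ->; rewrite mul0r ltxx.
have d0 : d != 0 by apply: contraTneq cd => ->; rewrite mulr0 ltxx.
have cd' : 0 < c / d.
  have -> : c / d = c * d * d ^- 2 by field.
  by rewrite mulr_gt0 // invr_gt0 exprn_even_gt0.
exists (ln (c / d) / 2) => //.
set t := ln (c / d) / 2.
have E : expR t * expR t = c / d.
  by rewrite -expRD -splitr lnK // posrE.
apply: (represents_inj (geodP t)).
have -> : hline t = (expR t / c) *: (c *: A + d *: B).
  rewrite scalerDr !scalerA divfK // /hline expRN; congr (_ + _ *: _).
  apply: (mulIf (exp_neq0 t)); rewrite mulVf ?exp_neq0 //.
  rewrite [RHS](_ : _ = expR t * expR t * (d / c)); last by field.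
  by rewrite E; field; rewrite c0.
apply: represents_scaleR => //.
by rewrite mulf_neq0 ?invr_eq0 ?exp_neq0.
Qed.

(** The ratio of the two coefficients of [e^t A + e^-t B] is e^(2 t). *)
Definition time (x : P2 R) : R := ln (mink_ratio B A x) / 2.

Lemma mink_ratio_geod t : mink_ratio B A (geod t) = expR t ^+ 2.
Proof.
rewrite (mink_ratioE _ _ (geodP t)) mink_hlineA mink_hlineB expRN.
by field; rewrite exp_neq0 ltr0_neq0.
Qed.

Lemma geodK : cancel geod time.
Proof.
move=> t; rewrite /time mink_ratio_geod -expRM_natl expRK mulrC.
by rewrite mulr_natl mulr2n; field.
Qed.

Lemma time_cvg (U : Type) (F : set_system U) (h : U -> P2 R) t :
  Filter F -> h @ F --> geod t -> time (h s) @[s --> F] --> t.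
Proof.
move=> FF hx; rewrite -[X in _ --> X]geodK.
apply: cvgM; last exact: cvg_cst.
have A0 : mink (hline t) A != 0.
  by rewrite mink_hlineA mulf_neq0 ?exp_neq0 // ltr0_neq0.
have H := @mink_ratio_cvg_comp _ _ h B A _ _ hx (geodP t) A0.
apply: (cvg_comp _ _ H); apply: continuous_ln.
by rewrite mink_ratio_geod exprn_gt0 ?expR_gt0.
Qed.

Lemma hline_cvg (U : Type) (F : set_system U) (h k : U -> R) c d :
  Filter F -> h s @[s --> F] --> c -> k s @[s --> F] --> d ->
  h s *: A + k s *: B @[s --> F] --> c *: A + d *: B.
Proof.
move=> FF hc kd; apply: cvg_rV => i.
under [X in X @ _]eq_fun do rewrite !mxE.
by rewrite !mxE; apply: cvgD; apply: cvgM => //; exact: cvg_cst.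
Qed.

Lemma geod_continuous : continuous geod.
Proof.
move=> t; apply: (@cvg_P2 _ _ (nbhs t) hline geod _ _ _ (geodP t)); last first.
  by apply: nearW => s; exact: geodP.
apply: hline_cvg; first exact: continuous_expR.
apply: (@continuous_comp _ _ _ -%R expR); first exact: opp_continuous.
exact: continuous_expR.
Qed.

(** Rescaled by e^-t the lift is A + e^(-2 t) B, which converges to A. *)
Lemma geod_cvg_pinfty (alpha : P2 R) : represents A alpha ->
  geod t @[t --> +oo] --> alpha.
Proof.
move=> Aa; pose h t := 1 *: A + expR (- (2 * t)) *: B.
apply: (@cvg_P2 _ _ +oo%R h geod _ _ _ Aa).
  rewrite -[X in _ --> X](_ : 1 *: A + 0 *: B = _); last first.
    by rewrite scale1r scale0r addr0.
  apply: hline_cvg; first exact: cvg_cst.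
  apply: (@cvg_comp _ _ _ (fun t : R => 2 * t) (fun t => expR (- t)) _ +oo).
    exact: (gt0_cvgMry (ltr0Sn R 1) (@cvg_id _ +oo%R)).
  exact: cvgr_expR.
apply: nearW => t.
have -> : h t = expR (- t) *: hline t.
  rewrite scalerDr !scalerA -!expRD addNr expR0.
  by congr (_ + expR _ *: _); ring.
apply: represents_scaleR; [exact: exp_neq0|exact: geodP].
Qed.

Definition geod_space : {vspace 'rV[R]_3} := (<[A]> + <[B]>)%VS.

Lemma geod_spaceP v :
  reflect (exists c d, v = c *: A + d *: B) (v \in geod_space).
Proof.
apply: (iffP memv_addP) => [[_ /vlineP[c ->] [_ /vlineP[d ->] ->]]|[c [d ->]]].
  by exists c, d.
exists (c *: A); first exact/vlineP/ex_intro.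
by exists (d *: B); first exact/vlineP/ex_intro.
Qed.

Lemma dim_geod_space : \dim geod_space = 2.
Proof.
rewrite dimv_disjoint_sum ?dim_vline.
  have -> : A != 0 := null_pair_nonzero nullAB.
  by have -> : B != 0 := null_pair_nonzero (null_pair_sym nullAB).
apply/eqP; rewrite -subv0; apply/subvP => v /memv_capP[/vlineP[c ->] /vlineP[d]].
move=> /(congr1 (mink ^~ B)); rewrite !minkZl BB mulr0 => /eqP.
by rewrite mulf_eq0 (lt_eqF AB) orbF => /eqP->; rewrite scale0r mem0v.
Qed.

Lemma range_geodE : range geod = projective_line geod_space `&` H2.
Proof.
apply/seteqP; split=> [_ [t _ <-]|x].
  split.
    by exists (hline t); [exact: geodP|apply/geod_spaceP; do 2!eexists].
  exists (hline t); first exact: geodP.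
  rewrite {2}/hline minkDr !minkZr mink_hlineA mink_hlineB !mulrA.
  rewrite [expR (- t) * expR t]mulrC -expRD addrN expR0 mul1r.
  by have := AB; lra.
move=> [[v vx /geod_spaceP[c [d vE]]] [w wx w0]]; apply/range_geodP; exists c, d.
split; last by rewrite -vE.
have [k _ wE] := represents_ratio vx wx.
move: w0; rewrite wE vE !minkE AA BB (minkC B A) => w0.
have k2 : 0 <= k ^+ 2 := sqr_ge0 k.
have {}w0 : k ^+ 2 * (c * d * (2 * mink A B)) < 0 by lra.
have k0 : 0 < k ^+ 2.
  by rewrite lt_def k2 andbT; apply: contraTneq w0 => ->; rewrite mul0r ltxx.
by move: w0; rewrite pmulr_rlt0 // nmulr_llt0 //; have := AB; lra.
Qed.

Lemma geodesic_range_geod : geodesic (range geod).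
Proof.
split; first by exists (geod 0), 0.
by exists geod_space; [exact: dim_geod_space|exact: range_geodE].
Qed.

Definition geod_lt (x y : P2 R) : Prop :=
  exists s t, [/\ s < t, geod s = x & geod t = y].

Lemma parametrizes_geod : parametrizes (range geod) geod_lt geod.
Proof.
split=> //; first exact: geod_continuous.
exact: can_inj geodK.
Qed.

Definition oriented_geod : oriented_geodesic R :=
  OrientedGeodesic geodesic_range_geod (ex_intro _ _ parametrizes_geod).
End NullPair.

Lemma range_eq_cover (f g : R -> P2 R) : range f = range g ->
  forall t, exists s, g s = f t.
Proof.
move=> fg t; have [s _ sE] : range g (f t) by rewrite -fg; exists t.
by exists s.
Qed.

Lemma geod_swap A B (AB : null_pair A B) (BA : null_pair B A) t :
  geod BA t = geod AB (- t).
Proof.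
have := geodP AB (- t); rewrite /hline opprK addrC => h.
exact: represents_inj (geodP BA t) h.
Qed.

Lemma geod_cvg_ninfty A B (AB : null_pair A B) (beta : P2 R) :
  represents B beta -> geod AB t @[t --> -oo] --> beta.
Proof.
move=> Bb; apply/cvgNy_compNP.
have H := geod_cvg_pinfty (null_pair_sym AB) Bb.
rewrite (_ : _ \o _ = geod (null_pair_sym AB)) //.
by apply/funext => t; rewrite /= (geod_swap AB).
Qed.

Lemma goes_from_to_geod A B (AB : null_pair A B) (alpha beta : P2 R) :
  represents A alpha -> represents B beta ->
  goes_from_to (oriented_geod AB) beta alpha.
Proof.
move=> Aa Bb; exists (geod AB); first exact: parametrizes_geod.
by split; [exact: geod_cvg_ninfty|exact: geod_cvg_pinfty].
Qed.

(** The inverse of geod turns any parametrization of the same geodesic into a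
    continuous injection phi of the real line; the orientation is that of
    geod, or the opposite one, according to whether phi increases or
    decreases. *)
Lemma oriented_geod_unique A B (AB : null_pair A B) (g : oriented_geodesic R) :
  og_points g = range (geod AB) ->
  g = oriented_geod AB \/ g = oriented_geod (null_pair_sym AB).
Proof.
move=> gE; have [h [hC hI hg hlt]] := og_oriented g.
have hAB : range h = range (geod AB) by rewrite hg.
pose phi t := time A B (h t).
have hphi t : geod AB (phi t) = h t.
  by have [s sE] := range_eq_cover hAB t; rewrite /phi -sE geodK.
have phiC : continuous phi.
  move=> t; apply: (@time_cvg _ _ AB _ (nbhs t) h); rewrite hphi; exact: hC.
have phiI : injective phi by move=> s t st; apply: hI; rewrite -!hphi st.
case: (continuous_injective_monotone phiC phiI) => phiM; [left|right].
- apply: oriented_geodesic_eq => // x y; rewrite hlt /=.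
  split=> -[s [t [st <- <-]]].
    by exists (phi s), (phi t); rewrite phiM !hphi.
  have [s' sE] := range_eq_cover (esym hAB) s.
  have [t' tE] := range_eq_cover (esym hAB) t.
  exists s', t'; split=> //; rewrite -phiM.
  by rewrite /phi sE tE !geodK.
- apply: oriented_geodesic_eq => [|x y].
    rewrite gE; apply/seteqP; split=> _ [t _ <-].
      by exists (- t) => //; rewrite (geod_swap AB) opprK.
    by exists (- t) => //; rewrite (geod_swap AB).
  rewrite hlt /=; split=> -[s [t [st <- <-]]].
    exists (- phi s), (- phi t).
    by rewrite ltrN2 phiM !(geod_swap AB) !opprK !hphi.
  rewrite !(geod_swap AB).
  have [s' sE] := range_eq_cover (esym hAB) (- s).
  have [t' tE] := range_eq_cover (esym hAB) (- t).
  exists s', t'; split=> //; rewrite -phiM.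
  by rewrite /phi sE tE !geodK ltrN2.
Qed.

Lemma increasing_cvg_pinfty (phi : R -> R) : {homo phi : s t / s < t} ->
  (forall s, exists t, phi t = s) -> phi t @[t --> +oo] --> +oo.
Proof.
move=> phiM phiS; apply/cvgryPge => a; have [t <-] := phiS a.
near=> s; apply/ltW/phiM; near: s.
by apply: nbhs_pinfty_gt; exact: num_real.
Unshelve. all: by end_near. Qed.

Lemma increasing_cvg_ninfty (phi : R -> R) : {homo phi : s t / s < t} ->
  (forall s, exists t, phi t = s) -> phi t @[t --> -oo] --> -oo.
Proof.
move=> phiM phiS; apply/cvgrNyPle => a; have [t <-] := phiS a.
near=> s; apply/ltW/phiM; near: s.
by apply: nbhs_ninfty_lt; exact: num_real.
Unshelve. all: by end_near. Qed.

(** Two parametrizations with the same order differ by an increasing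
    bijection of the real line, which preserves the limits at both infinities. *)
Lemma endpoints_unique (g : oriented_geodesic R) (x y x' y' : P2 R) :
  goes_from_to g x y -> goes_from_to g x' y' -> x = x' /\ y = y'.
Proof.
move=> [h [hC hI hg hlt] [hx hy]] [k [kC kI kg klt] [kx ky]].
have hk : range h = range k by rewrite hg kg.
have [phi phiE] := choice (range_eq_cover (esym hk)).
have phiM : {homo phi : s t / s < t}.
  move=> s t st; have /hlt[s' [t' [st' s'E t'E]]] : og_lt g (k s) (k t).
    by apply/klt; exists s, t.
  by rewrite (hI (phi s) s') 1?(hI (phi t) t') // phiE ?s'E ?t'E.
have phiS s : exists t, phi t = s.
  have [t tE] := range_eq_cover hk s.
  by exists t; apply: hI; rewrite phiE.
have kE : k = h \o phi by apply/funext => t; rewrite /= phiE.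
split.
- apply: (P2_cvg_unique (h := k) _ _ kx); rewrite kE.
  exact: cvg_comp (increasing_cvg_ninfty phiM phiS) hx.
- apply: (P2_cvg_unique (h := k) _ _ ky); rewrite kE.
  exact: cvg_comp (increasing_cvg_pinfty phiM phiS) hy.
Qed.

Lemma null_pair_orth v w : mink v v < 0 -> mink w v = 0 ->
  mink w w = - mink v v -> null_pair (v + w) (v - w).
Proof.
move=> vv wv ww; have vw : mink v w = 0 by rewrite minkC.
by split; rewrite !minkE wv vw ww; lra.
Qed.

(** In an orthogonal basis v, w of the plane with <w, w> = - <v, v>, the null
    directions are v + w and v - w. *)
Lemma lorentzian_plane (W : {vspace 'rV[R]_3}) v : \dim W = 2 -> v \in W ->
  mink v v < 0 -> exists A B, null_pair A B /\ W = geod_space A B.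
Proof.
move=> dW vW vv.
have [w0 w0W w0v] : exists2 w, w \in W & w \notin <[v]>%VS.
  apply/subvPn; apply/negP => /dimvS; rewrite dW dim_vline.
  by case: (v != 0).
pose w1 := w0 - (mink w0 v / mink v v) *: v.
have w1v : mink w1 v = 0 by rewrite !minkE divfK ?subrr // lt_eqF.
have w1W : w1 \in W by rewrite memvB // memvZ.
have w1n : w1 != 0.
  apply: contraNneq w0v => /eqP; rewrite subr_eq0 => /eqP->.
  by rewrite memvZ // memv_line.
clearbody w1; have w1p := mink_orth_gt0 vv w1v w1n.
pose w := Num.sqrt (- mink v v / mink w1 w1) *: w1.
have wW : w \in W by rewrite memvZ.
have ww : mink w w = - mink v v.
  rewrite minkZl minkZr mulrA -expr2 sqr_sqrtr ?divfK ?gt_eqF //.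
  by rewrite divr_ge0 ?ltW // oppr_gt0.
have wv : mink w v = 0 by rewrite minkZl w1v mulr0.
have N := null_pair_orth vv wv ww.
exists (v + w), (v - w); split=> //.
apply/eqP; rewrite eq_sym eqEdim (dim_geod_space N) dW leqnn andbT.
apply/subvP => _ /geod_spaceP[c [d ->]].
by apply: memvD; apply: memvZ; [exact: memvD|exact: memvB].
Qed.

Lemma oriented_geodesicP (g : oriented_geodesic R) :
  exists A B (AB : null_pair A B), g = oriented_geod AB.
Proof.
have [[x gx] [W dW gE]] := og_geodesic g.
have [v vW vv] : exists2 v, v \in W & mink v v < 0.
  move: gx; rewrite gE => -[[v vx vW] [w wx ww]]; exists w => //.
  by have [c _ ->] := represents_ratio vx wx; rewrite memvZ.
have [A [B [AB WE]]] := lorentzian_plane dW vW vv.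
have : og_points g = range (geod AB) by rewrite gE WE range_geodE.
move=> /oriented_geod_unique[gAB|gBA]; first by exists A, B, AB.
by exists B, A, (null_pair_sym AB).
Qed.

(** Write g as the geodesic of some null pair. Uniqueness of the ends makes
    its vectors proportional to A and B, so g has the points of the geodesic of
    (A, B); the opposite orientation is excluded since it exchanges the ends,
    which are distinct. *)
Lemma goes_from_toP A B (AB : null_pair A B) (alpha beta : P2 R) g :
  represents A alpha -> represents B beta ->
  goes_from_to g beta alpha <-> g = oriented_geod AB.
Proof.
move=> Aa Bb; split=> [|->]; last exact: goes_from_to_geod.
have [A' [B' [AB' ->]]] := oriented_geodesicP g => gba.
have [alpha' A'a] := represents_ex (null_pair_nonzero AB').
have [beta' B'b] := represents_ex (null_pair_nonzero (null_pair_sym AB')).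
have [] := endpoints_unique gba (goes_from_to_geod AB' A'a B'b).
move=> bb aa; move: A'a B'b; rewrite -aa -bb => A'a B'b.
have [c c0 A'E] := represents_ratio Aa A'a.
have [d d0 B'E] := represents_ratio Bb B'b.
have cd : 0 < c * d.
  have [_ _] := AB; have [_ _] := AB'; rewrite A'E B'E !minkE mulrA => h1 h2.
  by move: h1; rewrite nmulr_llt0.
have : og_points (oriented_geod AB') = range (geod AB).
  rewrite /= !range_geodE; congr (projective_line _ `&` _); apply/eqP.
  rewrite eqEdim !dim_geod_space // leqnn andbT; apply/subvP => v.
  move=> /geod_spaceP[e [k ->]]; apply/geod_spaceP; exists (e * c), (k * d).
  by rewrite A'E B'E !scalerA.
move=> /oriented_geod_unique[//|E].
have := goes_from_to_geod AB' A'a B'b; rewrite E => E'.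
have [ba _] := endpoints_unique E' (goes_from_to_geod (null_pair_sym AB) Bb Aa).
rewrite ba in Bb; have [k _ BE] := represents_ratio Aa Bb.
by exfalso; have [AA _] := AB; rewrite BE minkZr AA mulr0 ltxx.
Qed.

(** * Split-complex vectors and the conic of null lines *)
Section SplitComplex.
Local Notation Cs := (R * R)%type.
Implicit Types (p q : 'rV[Cs]_2) (x y : regular R).

Lemma Cs_unitE (c : Cs) : (c \is a GRing.unit) = (c.1 != 0) && (c.2 != 0).
Proof. by rewrite -!unitfE. Qed.

Lemma fst_mulCs (c d : Cs) : (c * d).1 = c.1 * d.1. Proof. by []. Qed.
Lemma snd_mulCs (c d : Cs) : (c * d).2 = c.2 * d.2. Proof. by []. Qed.
Lemma fst_addCs (c d : Cs) : (c + d).1 = c.1 + d.1. Proof. by []. Qed.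
Lemma snd_addCs (c d : Cs) : (c + d).2 = c.2 + d.2. Proof. by []. Qed.
Definition CsE := (fst_mulCs, snd_mulCs, fst_addCs, snd_addCs).

Lemma row2P (T : Type) (u v : 'rV[T]_2) : u 0 0 = v 0 0 -> u 0 1 = v 0 1 -> u = v.
Proof.
move=> e0 e1; apply/rowP => -[[|[|//]] i].
- by have -> : Ordinal i = 0 by exact: val_inj.
- by have -> : Ordinal i = 1 by exact: val_inj.
Qed.

Definition cvec (a a' b b' : R) : 'rV[Cs]_2 :=
  \row_(i < 2) [:: (a, a'); (b, b')]`_i.

Lemma cvecE a a' b b' :
  ((cvec a a' b b' 0 0 = (a, a')) * (cvec a a' b b' 0 1 = (b, b')))%type.
Proof. by rewrite !mxE. Qed.

Lemma cvec_eta p :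
  p = cvec (p 0 0).1 (p 0 0).2 (p 0 1).1 (p 0 1).2.
Proof. by apply: row2P; rewrite cvecE; [case: (p 0 0)|case: (p 0 1)]. Qed.

Lemma good_cvec a a' b b' : good R (cvec a a' b b') <->
  a ^+ 2 + b ^+ 2 != 0 /\ a' ^+ 2 + b' ^+ 2 != 0.
Proof.
have sq0 (s t : R) : s ^+ 2 + t ^+ 2 = 0 -> s = 0 /\ t = 0.
  by move=> st; split; nra.
rewrite /good/=; split=> [/(_ 1)[c [d]]|[ab ab'] z]; rewrite !cvecE.
  move=> E; split; apply/eqP => /sq0[s0 t0]; subst.
    have := congr1 fst E; rewrite !CsE /= !mul0r addr0 => /eqP.
    by rewrite oner_eq0.
  have := congr1 snd E; rewrite !CsE /= !mul0r addr0 => /eqP.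
  by rewrite oner_eq0.
exists (z * (a / (a ^+ 2 + b ^+ 2), a' / (a' ^+ 2 + b' ^+ 2))).
exists (z * (b / (a ^+ 2 + b ^+ 2), b' / (a' ^+ 2 + b' ^+ 2))).
by case: z => z z'; apply/pair_equal_spec; rewrite !CsE /=; split; field.
Qed.

(** The real number with <p, p> = (hdot p, hdot p). *)
Definition hdot p : R := (p 0 0).1 * (p 0 0).2 + (p 0 1).1 * (p 0 1).2.

Lemma hermE p : herm p p = (hdot p, hdot p).
Proof.
apply/pair_equal_spec; rewrite !CsE /hdot /conjs /=; split=> //.
by rewrite mulrC [X in _ + X]mulrC.
Qed.

Lemma herm_neq0 p : (herm p p != 0) = (hdot p != 0).
Proof.
rewrite hermE; apply/idP/idP; apply: contraNneq; first by move=> ->.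
by move=> /(congr1 fst) /= ->.
Qed.

Lemma fst_scale (c : Cs) p i : ((c *: p) 0 i).1 = c.1 * (p 0 i).1.
Proof. by rewrite mxE. Qed.

Lemma snd_scale (c : Cs) p i : ((c *: p) 0 i).2 = c.2 * (p 0 i).2.
Proof. by rewrite mxE. Qed.

Lemma hdot_scale (c : Cs) p : hdot (c *: p) = c.1 * c.2 * hdot p.
Proof. by rewrite /hdot !fst_scale !snd_scale; ring. Qed.

Lemma regularP p (x : P1 R) : represents p x -> regular R x <-> hdot p != 0.
Proof.
move=> px; split=> [[q qx]|]; last by rewrite -herm_neq0; exists p.
have [c] := represents_ratio px qx.
rewrite Cs_unitE => /andP[c1 c2] ->.
by rewrite herm_neq0 hdot_scale; apply: contraNneq => ->; rewrite mulr0.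
Qed.

Lemma regular_hdot p x : represents p (\val x) -> hdot p != 0.
Proof. by move=> px; apply/(regularP px); exact: set_valP. Qed.

Lemma endA_scale (c : Cs) p : endA (c *: p) = c.1 ^+ 2 *: endA p.
Proof.
by apply: row3P; rewrite /endA !fst_scale !mxE /=; ring.
Qed.

Lemma endB_scale (c : Cs) p : endB (c *: p) = c.2 ^+ 2 *: endB p.
Proof.
by apply: row3P; rewrite /endB !snd_scale !mxE /=; ring.
Qed.

Lemma endA_null p : mink (endA p) (endA p) = 0.
Proof. by rewrite /mink /endA !vec3E; ring. Qed.

Lemma endB_null p : mink (endB p) (endB p) = 0.
Proof. by rewrite /mink /endB !vec3E; ring. Qed.

Lemma mink_ends p : mink (endA p) (endB p) = - (2 * hdot p ^+ 2).
Proof. by rewrite /mink /endA /endB /hdot !vec3E; ring. Qed.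

Lemma null_pair_ends p : hdot p != 0 -> null_pair (endA p) (endB p).
Proof.
move=> h0; split; [exact: endA_null|exact: endB_null|].
by rewrite mink_ends oppr_lt0 mulr_gt0 // exprn_even_gt0.
Qed.

(** The parametrization of the conic of null lines by the real projective
    line. *)
Definition veronese (a b : R) : 'rV[R]_3 :=
  vec3 (a ^+ 2 + b ^+ 2) (a ^+ 2 - b ^+ 2) (2 * a * b).

Lemma endA_veronese p : endA p = veronese (p 0 0).1 (p 0 1).1.
Proof. by []. Qed.

Lemma endB_veronese p : endB p = veronese (p 0 1).2 (- (p 0 0).2).
Proof. by rewrite /endB /veronese; congr vec3; ring. Qed.

(** The point is [u0 + u1 : u2], except at the single null line with
    u0 + u1 = 0, where it is [0 : 1]. *)
Lemma null_vector_veronese u : u != 0 -> mink u u = 0 ->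
  exists a b k, k != 0 /\ veronese a b = k *: u.
Proof.
move=> u0; rewrite /mink => uu.
have [u01|u01] := eqVneq (u 0 0 + u 0 1) 0.
  have u1 : u 0 1 = - u 0 0 by lra.
  have u2 : u 0 2 = 0 by rewrite u1 in uu; nra.
  have u00 : u 0 0 != 0.
    apply: contraNneq u0 => u00; apply/eqP.
    by apply: row3P; rewrite mxE ?u1 ?u00 ?oppr0.
  exists 0, 1, (u 0 0)^-1; split; first by rewrite invr_eq0.
  by apply: row3P; rewrite /veronese vec3E mxE ?u1 ?u2; field.
have u00 : u 0 0 != 0.
  apply: contraNneq u01 => u00; apply/eqP; rewrite u00 in uu *; nra.
exists (u 0 0 + u 0 1), (u 0 2), (2 * (u 0 0 + u 0 1)); split.
  by rewrite mulf_neq0.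
apply: row3P; rewrite /veronese vec3E mxE; last by ring.
  have -> : u 0 2 ^+ 2 = u 0 0 ^+ 2 - u 0 1 ^+ 2 by lra.
  by ring.
have -> : u 0 2 ^+ 2 = u 0 0 ^+ 2 - u 0 1 ^+ 2 by lra.
by ring.
Qed.

Lemma row3_scaleE k u i : (k *: u) 0 i = k * u 0 i.
Proof. by rewrite mxE. Qed.

Lemma proportional2 (a b c d : R) : a ^+ 2 + b ^+ 2 != 0 -> a * d = b * c ->
  exists l, c = l * a /\ d = l * b.
Proof.
move=> ab adbc; exists ((a * c + b * d) / (a ^+ 2 + b ^+ 2)); split.
  have -> : (a * c + b * d) / (a ^+ 2 + b ^+ 2) * a =
    (a ^+ 2 * c + b * (a * d)) / (a ^+ 2 + b ^+ 2) by field.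
  by rewrite adbc; field.
have -> : (a * c + b * d) / (a ^+ 2 + b ^+ 2) * b =
    (a * (b * c) + b ^+ 2 * d) / (a ^+ 2 + b ^+ 2) by field.
by rewrite -adbc; field.
Qed.

(** Comparing the two vectors gives c^2 = k a^2, d^2 = k b^2, c d = k a b, and
    then (a d - b c)^2 = 0. *)
Lemma veronese_inj (a b c d k : R) : a ^+ 2 + b ^+ 2 != 0 ->
  veronese c d = k *: veronese a b ->
  exists l, c = l * a /\ d = l * b.
Proof.
move=> ab E.
have /= := congr1 (fun v : 'rV[R]_3 => v 0 0) E.
have /= := congr1 (fun v : 'rV[R]_3 => v 0 1) E.
have /= := congr1 (fun v : 'rV[R]_3 => v 0 2) E.
rewrite !row3_scaleE /veronese !vec3E => e2 e1 e0.
have c2 : c ^+ 2 = k * a ^+ 2 by lra.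
have d2 : d ^+ 2 = k * b ^+ 2 by lra.
have cd : c * d = k * (a * b) by lra.
have : (a * d - b * c) ^+ 2 = 0.
  rewrite (_ : _ ^+ 2 = a ^+ 2 * d ^+ 2 + b ^+ 2 * c ^+ 2 - 2 * a * b * (c * d)).
    by rewrite c2 d2 cd; ring.
  by ring.
move=> /eqP; rewrite sqrf_eq0 subr_eq0 => /eqP adbc.
exact: proportional2.
Qed.

Lemma regular_eq_proportional x y p q l l' : represents p (\val x) ->
  represents q (\val y) ->
  (q 0 0).1 = l * (p 0 0).1 -> (q 0 1).1 = l * (p 0 1).1 ->
  (q 0 0).2 = l' * (p 0 0).2 -> (q 0 1).2 = l' * (p 0 1).2 -> x = y.
Proof.
move=> px qy q00 q10 q01 q11; apply: val_inj.
have qE : q = ((l, l') : Cs) *: p.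
  by apply: row2P; apply: injective_projections; rewrite ?fst_scale ?snd_scale.
have gq := represents_in qy.
have hq : l * l' != 0.
  have := regular_hdot qy; rewrite qE hdot_scale.
  by apply: contraNneq => /= ->; rewrite mul0r.
apply: (represents_inj (u := q)) => //; rewrite qE.
apply: represents_scale => //; last by rewrite -qE.
by rewrite Cs_unitE /= -negb_or -mulf_eq0.
Qed.

Lemma hdot_good p : hdot p != 0 -> good R p.
Proof.
move=> h0; rewrite (cvec_eta p); apply/good_cvec.
split; apply: contraNneq h0 => E; rewrite /hdot.
  have -> : (p 0 0).1 = 0 by nra.
  have -> : (p 0 1).1 = 0 by nra.
  by rewrite !mul0r addr0.
have -> : (p 0 0).2 = 0 by nra.
have -> : (p 0 1).2 = 0 by nra.
by rewrite !mulr0 addr0.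
Qed.

Lemma regular_ex p : hdot p != 0 -> exists x, represents p (\val x).
Proof.
move=> h0; have [x px] := represents_ex (hdot_good h0).
by exists (SigSub (mem_set ((regularP px).2 h0))).
Qed.

(** * The correspondence with oriented geodesics *)
Definition regular_geodesic (x : regular R) : oriented_geodesic R :=
  oriented_geod (null_pair_ends (regular_hdot (represents_repr (\val x)))).

Lemma regular_geodesicP x p : represents p (\val x) ->
  exists alpha beta : P2 R,
    [/\ represents (endA p) alpha, represents (endB p) beta,
        bdH2 alpha, bdH2 beta &
        forall g, goes_from_to g beta alpha <-> g = regular_geodesic x].
Proof.
move=> px; set q := \val (repr (\val x)).
have qx : represents q (\val x) := represents_repr _.
have N := null_pair_ends (regular_hdot qx).
have [alpha qa] := represents_ex (null_pair_nonzero N).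
have [beta qb] := represents_ex (null_pair_nonzero (null_pair_sym N)).
have [c] := represents_ratio qx px; rewrite Cs_unitE => /andP[c1 c2] pE.
exists alpha, beta; split.
- by rewrite pE endA_scale; apply: represents_scaleR => //; rewrite expf_neq0.
- by rewrite pE endB_scale; apply: represents_scaleR => //; rewrite expf_neq0.
- by exists (endA q) => //; exact: endA_null.
- by exists (endB q) => //; exact: endB_null.
- by move=> g; exact: goes_from_toP.
Qed.

Lemma endA_endB_inj x y (alpha beta : P2 R) p q : represents p (\val x) ->
  represents q (\val y) -> represents (endA p) alpha ->
  represents (endB p) beta -> represents (endA q) alpha ->
  represents (endB q) beta -> x = y.
Proof.
move=> px qy pa pb qa qb.
have := represents_in px; rewrite (cvec_eta p) => /good_cvec[pg pg'].
have [k _ kE] := represents_ratio pa qa; have [l _ lE] := represents_ratio pb qb.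
rewrite !endA_veronese in kE; rewrite !endB_veronese in lE.
have [c [c0 c1]] := veronese_inj pg kE.
have [d [d1 d0]] : exists d, (q 0 1).2 = d * (p 0 1).2 /\
    - (q 0 0).2 = d * - (p 0 0).2.
  by apply: veronese_inj lE; rewrite sqrrN addrC.
have {}d0 : (q 0 0).2 = d * (p 0 0).2 by lra.
exact: regular_eq_proportional px qy c0 c1 d0 d1.
Qed.

(** The ends of the geodesic are determined by it, and they determine [a : b]
    and [a' : b'] since the conic is parametrized injectively. *)
Lemma regular_geodesic_inj : injective regular_geodesic.
Proof.
move=> x y xy.
have [a [b [pa pb _ _ gx]]] := regular_geodesicP (represents_repr (\val x)).
have [a' [b' [qa qb _ _ gy]]] := regular_geodesicP (represents_repr (\val y)).
have H := (gx _).2 erefl; have H' := (gy _).2 erefl; rewrite -xy in H'.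
have [bb aa] := endpoints_unique H H'; rewrite -aa -bb in qa qb.
exact: endA_endB_inj (represents_repr _) (represents_repr _) pa pb qa qb.
Qed.

Lemma regular_geodesic_surj g : exists x, regular_geodesic x = g.
Proof.
have [A [B [AB ->]]] := oriented_geodesicP g; have [AA BB ABn] := AB.
have [a [b [k [k0 aE]]]] := null_vector_veronese (null_pair_nonzero AB) AA.
have [b' [c [l [l0 bE]]]] :=
  null_vector_veronese (null_pair_nonzero (null_pair_sym AB)) BB.
pose p := cvec a (- c) b b'.
have pA : endA p = k *: A by rewrite -aE endA_veronese !cvecE.
have pB : endB p = l *: B by rewrite -bE endB_veronese !cvecE /= opprK.
have h0 : hdot p != 0.
  have : mink (endA p) (endB p) != 0.
    by rewrite pA pB minkZl minkZr !mulf_neq0 // ltr0_neq0.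
  by rewrite mink_ends; apply: contraNneq => ->; rewrite expr0n mulr0 oppr0.
have [x px] := regular_ex h0.
have [alpha [beta [pa pb _ _ gx]]] := regular_geodesicP px.
exists x; apply/esym/gx; apply: goes_from_to_geod.
  have -> : A = k^-1 *: endA p by rewrite pA scalerA mulVf // scale1r.
  by apply: represents_scaleR => //; rewrite invr_eq0.
have -> : B = l^-1 *: endB p by rewrite pB scalerA mulVf // scale1r.
by apply: represents_scaleR => //; rewrite invr_eq0.
Qed.

Lemma regular_geodesic_bij : bijective regular_geodesic.
Proof.
have [h hK] := choice regular_geodesic_surj.
by exists h => // x; apply: regular_geodesic_inj.
Qed.

(** * The double cover and its fibers *)
Lemma liftf_scale (c : Cs) p : liftf (c *: p) = (c.1 * c.2) *: liftf p.
Proof.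
by apply: row3P; rewrite /liftf !fst_scale !snd_scale row3_scaleE !vec3E; ring.
Qed.

Lemma mink_liftf p : mink (liftf p) (liftf p) = hdot p ^+ 2.
Proof. by rewrite /mink /liftf /hdot !vec3E; ring. Qed.

Lemma cross_ends p : cross (endA p) (endB p) = (2 * hdot p) *: liftf p.
Proof.
by apply: row3P; rewrite /cross /endA /endB /liftf /hdot row3_scaleE !vec3E; ring.
Qed.

Lemma dS2P u (y : P2 R) : represents u y -> dS2 R y <-> 0 < mink u u.
Proof.
move=> uy; split=> [[w wy]|]; last by exists u.
have [c] := represents_ratio uy wy; rewrite unitfE => c0 ->.
by rewrite !minkE mulrA pmulr_rgt0 // -expr2 exprn_even_gt0.
Qed.

Lemma liftf_gt0 p : hdot p != 0 -> 0 < mink (liftf p) (liftf p).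
Proof. by move=> h0; rewrite mink_liftf exprn_even_gt0. Qed.

Lemma liftf_nonzero p : hdot p != 0 -> nonzero (liftf p).
Proof. by move=> /liftf_gt0 /lt0r_neq0; exact: nonzero_mink. Qed.

Definition cross_map x : dS2 R :=
  let h0 := regular_hdot (represents_repr (\val x)) in
  SigSub (mem_set ((dS2P (point_atP (liftf_nonzero h0))).2 (liftf_gt0 h0))).

Lemma cross_mapP x p : represents p (\val x) ->
  represents (liftf p) (\val (cross_map x)).
Proof.
move=> px; have [c] := represents_ratio (represents_repr (\val x)) px.
rewrite Cs_unitE => /andP[c1 c2] ->; rewrite liftf_scale.
by apply: represents_scaleR; [rewrite mulf_neq0|exact: point_atP].
Qed.

(** Exchanges the two ends: endA (swap p) = endB p and
    endB (swap p) = endA p. *)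
Definition swap p := cvec (p 0 1).2 (- (p 0 1).1) (- (p 0 0).2) (p 0 0).1.

Lemma liftf_swap p : liftf (swap p) = liftf p.
Proof. by rewrite /liftf !cvecE /=; congr vec3; ring. Qed.

Lemma hdot_swap p : hdot (swap p) = - hdot p.
Proof. by rewrite /hdot !cvecE /=; ring. Qed.

(** The four products a a', a b', b a', b b' are linear combinations of the
    coordinates of liftf p and of hdot p, so the matrices (a, b)^T (a', b') of
    p and q are proportional; a rank one matrix determines its column and row
    up to scaling. *)
Lemma liftf_hdot_inj x y p q c : represents p (\val x) ->
  represents q (\val y) -> liftf q = c *: liftf p -> hdot q = c * hdot p ->
  x = y.
Proof.
move=> px qy E h.
have := represents_in px; rewrite (cvec_eta p) => /good_cvec[pg pg'].
have := represents_in qy; rewrite (cvec_eta q) => /good_cvec[qg qg'].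
have := congr1 (fun v : 'rV[R]_3 => v 0 2) E.
have := congr1 (fun v : 'rV[R]_3 => v 0 1) E.
have := congr1 (fun v : 'rV[R]_3 => v 0 0) E.
rewrite !row3_scaleE !vec3E => E0 E1 E2; move: h; rewrite /hdot => h.
set a := (p 0 0).1 in pg E0 E1 E2 h *; set a' := (p 0 0).2 in pg' E0 E1 E2 h *.
set b := (p 0 1).1 in pg E0 E1 E2 h *; set b' := (p 0 1).2 in pg' E0 E1 E2 h *.
set d := (q 0 0).1 in qg E0 E1 E2 h *; set d' := (q 0 0).2 in qg' E0 E1 E2 h *.
set e := (q 0 1).1 in qg E0 E1 E2 h *; set e' := (q 0 1).2 in qg' E0 E1 E2 h *.
have F1 : d * d' = c * (a * a') by lra.
have F2 : d * e' = c * (a * b') by lra.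
have F3 : e * d' = c * (b * a') by lra.
have F4 : e * e' = c * (b * b') by lra.
have zero (s t r : R) : s ^+ 2 + t ^+ 2 != 0 -> r * s = 0 -> r * t = 0 -> r = 0.
  move=> st rs rt; have : r * (s ^+ 2 + t ^+ 2) = 0.
    by rewrite mulrDr !expr2 !mulrA rs rt !mul0r addr0.
  by move=> /eqP; rewrite mulf_eq0 (negbTE st) orbF => /eqP.
have [l [dl el]] : exists l, d = l * a /\ e = l * b.
  apply: proportional2 => //; apply/eqP; rewrite -subr_eq0; apply/eqP.
  apply: (zero d' e') => //.
    by rewrite mulrBl -!mulrA F3 F1; ring.
  by rewrite mulrBl -!mulrA F4 F2; ring.
have [l' [dl' el']] : exists l, d' = l * a' /\ e' = l * b'.
  apply: proportional2 => //; apply/eqP; rewrite -subr_eq0; apply/eqP.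
  apply: (zero d e) => //.
    by rewrite mulrBl -!mulrA [e' * d]mulrC [d' * d]mulrC F1 F2; ring.
  by rewrite mulrBl -!mulrA [e' * e]mulrC [d' * e]mulrC F3 F4; ring.
exact: regular_eq_proportional px qy dl el dl' el'.
Qed.

Lemma swap_ex x : exists x', forall p, represents p (\val x) ->
  represents (swap p) (\val x').
Proof.
have px := represents_repr (\val x); set p := \val (repr (\val x)) in px.
have h0 : hdot (swap p) != 0 by rewrite hdot_swap oppr_eq0 (regular_hdot px).
have [x' px'] := regular_ex h0; exists x' => q qx.
have [c cu ->] := represents_ratio px qx.
have -> : swap (c *: p) = ((c.2, c.1) : Cs) *: swap p.
  by apply: row2P; apply: injective_projections; rewrite ?fst_scale ?snd_scale
    /swap !cvecE /= ?fst_scale ?snd_scale; ring.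
have cu' : ((c.2, c.1) : Cs) \is a GRing.unit.
  by move: cu; rewrite !Cs_unitE andbC.
by apply: represents_scale => //; apply: good_scale => //; exact: represents_in px'.
Qed.

(** Since h^2 = <n, n>, rescaling n by c rescales h by c up to sign. *)
Lemma cross_map_fiber x y p q : represents p (\val x) ->
  represents q (\val y) -> cross_map x = cross_map y ->
  exists c, liftf q = c *: liftf p /\
            (hdot q = c * hdot p \/ hdot q = - c * hdot p).
Proof.
move=> px qy xy; have := cross_mapP qy; rewrite -xy => qx.
have [c _ qE] := represents_ratio (cross_mapP px) qx.
exists c; split=> //; have := mink_liftf q.
rewrite qE minkZl minkZr mink_liftf mulrA -expr2 -exprMn => /esym/eqP.
by rewrite eqf_sqr mulNr => /orP[/eqP|/eqP]; [left|right].
Qed.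

(** A unit c with swap p = c p would satisfy c.1 c.2 = - 1 by comparing hdot,
    and c.1 c.2 = 1 by comparing liftf. *)
Lemma swap_neq x x' p : represents p (\val x) ->
  represents (swap p) (\val x') -> x <> x'.
Proof.
move=> px px' xx'; rewrite -xx' in px'; have [c _ cE] := represents_ratio px px'.
have h0 := regular_hdot px.
have := liftf_swap p; rewrite cE liftf_scale => lE.
have := hdot_swap p; rewrite cE hdot_scale => hE.
have c1 : c.1 * c.2 = -1 by apply: (mulIf h0); rewrite hE mulN1r.
have := mink_liftf p; rewrite -[X in mink X _]lE c1 minkZl mink_liftf => E.
have : 0 < hdot p ^+ 2 by rewrite exprn_even_gt0.
by lra.
Qed.

Lemma cross_map_swap x x' p : represents p (\val x) ->
  represents (swap p) (\val x') -> cross_map x' = cross_map x.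
Proof.
move=> px px'; apply: val_inj; have := cross_mapP px'; rewrite liftf_swap.
by move=> H; exact: (represents_inj H (cross_mapP px)).
Qed.

(** With s^2 = <n, n> the matrix with rows (s - n2, n1 + n0) and
    (n1 - n0, s + n2) has determinant 0 and trace 2 s; p is read off from the
    column and the row through a nonzero diagonal entry. *)
Lemma cross_map_surj (y : dS2 R) : exists x, cross_map x = y.
Proof.
have ny := represents_repr (\val y); set n := \val (repr (\val y)) in ny.
have n0 : 0 < mink n n by apply/(dS2P ny); exact: set_valP.
pose s := Num.sqrt (mink n n); have s0 : 0 < s by rewrite sqrtr_gt0.
have ss : s ^+ 2 = mink n n by rewrite sqr_sqrtr // ltW.
suff [p [k [k0 lE hE]]] :
    exists p k, [/\ k != 0, liftf p = k *: n & hdot p = k * s].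
  have [x px] : exists x, represents p (\val x).
    by apply: regular_ex; rewrite hE mulf_neq0 // gt_eqF.
  exists x; apply: val_inj; apply: represents_inj (cross_mapP px) _.
  by rewrite lE; exact: represents_scaleR.
(* The diagonal entries s - n2 and s + n2 are not both 0, as s > 0. *)
have [sn|sn] := eqVneq (s - n 0 2) 0.
  exists (cvec (n 0 0 + n 0 1) (n 0 1 - n 0 0) (s + n 0 2) (s + n 0 2)).
  exists (2 * (s + n 0 2)).
  split; first by rewrite mulf_neq0 //; lra.
    apply: row3P; rewrite row3_scaleE vec3E !cvecE /=; rewrite /mink in ss; lra.
  by rewrite /hdot !cvecE /=; rewrite /mink in ss; lra.
exists (cvec (s - n 0 2) (s - n 0 2) (n 0 1 - n 0 0) (n 0 0 + n 0 1)).
exists (2 * (s - n 0 2)).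
split; first by rewrite mulf_neq0.
  apply: row3P; rewrite row3_scaleE vec3E !cvecE /=; rewrite /mink in ss; lra.
by rewrite /hdot !cvecE /=; rewrite /mink in ss; lra.
Qed.

Lemma card_eq_set2 (T : Type) (x y : T) : x <> y -> ([set x; y] #= `I_2)%card.
Proof.
move=> xy; apply/card_set_bijP; exists (fun z => if `[<z = x>] then 0%N else 1%N).
have yx : `[<y = x>] = false by apply/asboolPn => yx; exact: xy.
have xx : `[<x = x>] = true by apply/asboolP.
split.
- by move=> _ [->|->]; rewrite /= ?xx ?yx.
- by move=> u v; rewrite !inE => -[->|->] [->|->]; rewrite ?xx ?yx.
- by move=> [|[|//]] _; [exists x; [left|rewrite xx]|exists y; [right|rewrite yx]].
Qed.

Lemma two_to_one_cross_map : two_to_one cross_map.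
Proof.
move=> y; have [x xy] := cross_map_surj y; have [x' x'P] := swap_ex x.
have px := represents_repr (\val x); set p := \val (repr (\val x)) in px.
have -> : cross_map @^-1` [set y] = [set x; x'].
  apply/seteqP; split=> z /=; last first.
    by move=> [->|->] //; rewrite (cross_map_swap px) //; exact: x'P.
  have qz := represents_repr (\val z); rewrite -xy => /esym /(cross_map_fiber px qz).
  move=> [c [lE [hE|hE]]]; [left|right].
    by apply/esym; exact: liftf_hdot_inj px qz lE hE.
  apply/esym; apply: (@liftf_hdot_inj _ _ _ _ c (x'P _ px) qz).
    by rewrite liftf_swap.
  by rewrite hdot_swap mulrN -mulNr.
exact: card_eq_set2 (swap_neq px (x'P _ px)).
Qed.

(** * Even covering *)
Lemma nbhs_regular p x (N : set (regular R)) : represents p (\val x) ->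
  nbhs x N <->
  nbhs p [set q | forall x' : regular R, represents q (\val x') -> N x'].
Proof.
move=> px; apply: iff_trans (nbhs_set_type _ _) _.
apply: iff_trans (nbhs_P1 _ px) _; split; apply: filterS => q qN x'.
  by move=> qx'; exact: qN qx' _ erefl.
by move=> qx' z zx'; apply: qN; rewrite zx'.
Qed.

Lemma nbhs_dS2 u (y : dS2 R) (N : set (dS2 R)) : represents u (\val y) ->
  nbhs y N <->
  nbhs u [set v | forall y' : dS2 R, represents v (\val y') -> N y'].
Proof.
move=> uy; apply: iff_trans (nbhs_set_type _ _) _.
apply: iff_trans (nbhs_P2 _ uy) _; split; apply: filterS => v vN y'.
  by move=> vy'; exact: vN vy' _ erefl.
by move=> vy' z zy'; apply: vN; rewrite zy'.
Qed.

Lemma coord_cvg p i :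
  (q 0 i).1 @[q --> nbhs p] --> (p 0 i).1 /\
  (q 0 i).2 @[q --> nbhs p] --> (p 0 i).2.
Proof.
have H : (q 0 i) @[q --> nbhs p] --> p 0 i by exact: coord_rV_continuous.
split.
  exact: (cvg_comp _ fst H cvg_fst).
exact: (cvg_comp _ snd H cvg_snd).
Qed.

Lemma vec3_cvg (U : Type) (F : set_system U) (h k l : U -> R) (a b c : R) :
  Filter F -> h t @[t --> F] --> a -> k t @[t --> F] --> b ->
  l t @[t --> F] --> c -> vec3 (h t) (k t) (l t) @[t --> F] --> vec3 a b c.
Proof.
move=> FF ha kb lc; apply: cvg_rV => i.
by case: i => -[|[|[|//]]] ?; under [X in X @ _]eq_fun do rewrite !mxE /=;
  rewrite !mxE.
Qed.

Lemma cvec_cvg (U : Type) (F : set_system U) (h h' k k' : U -> R)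
    (a a' b b' : R) : Filter F ->
  h t @[t --> F] --> a -> h' t @[t --> F] --> a' ->
  k t @[t --> F] --> b -> k' t @[t --> F] --> b' ->
  cvec (h t) (h' t) (k t) (k' t) @[t --> F] --> cvec a a' b b'.
Proof.
move=> FF ha ha' kb kb'; apply: cvg_rV => i.
have ah : ((h t, h' t) : Cs) @[t --> F] --> ((a, a') : Cs).
  exact: (@cvg_pair _ _ _ F (nbhs a) (nbhs a') FF _ _ h h').
have bk : ((k t, k' t) : Cs) @[t --> F] --> ((b, b') : Cs).
  exact: (@cvg_pair _ _ _ F (nbhs b) (nbhs b') FF _ _ k k').
by case: i => -[|[|//]] ?; under [X in X @ _]eq_fun do rewrite !mxE /=;
  rewrite !mxE.
Qed.

Lemma liftf_continuous : continuous (@liftf R).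
Proof.
move=> p; have [a a'] := coord_cvg p 0; have [b b'] := coord_cvg p 1.
apply: (@vec3_cvg _ (nbhs p)).
- by apply: cvgB; exact: cvgM.
- by apply: cvgD; exact: cvgM.
- by apply: cvgD; [apply: cvgN|]; exact: cvgM.
Qed.

Lemma hdot_continuous : continuous hdot.
Proof.
move=> p; have [a a'] := coord_cvg p 0; have [b b'] := coord_cvg p 1.
by apply: (@cvgD _ _ _ (nbhs p)); apply: cvgM.
Qed.

Lemma cross_map_continuous : continuous cross_map.
Proof.
move=> x N; have px := represents_repr (\val x).
set p := \val (repr (\val x)) in px.
move=> /(nbhs_dS2 _ (cross_mapP px)) fN.
apply: (nbhs_regular (cross_map @^-1` N) px).2.
have : nbhs p (@liftf R @^-1` _) := liftf_continuous fN.
by apply: filterS => q qN x' qx'; apply: qN; exact: cross_mapP.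
Qed.

Section Sheets.
Variable m : 'rV[R]_3.

(** Under p |-> c p this is multiplied by the square of c.1 c.2, so its sign
    depends on [p] only. *)
Definition signed p : R := mink (liftf p) m * hdot p.

Lemma signed_scale (c : Cs) p : signed (c *: p) = (c.1 * c.2) ^+ 2 * signed p.
Proof. by rewrite /signed liftf_scale hdot_scale minkZl; ring. Qed.

Lemma signed_swap p : signed (swap p) = - signed p.
Proof. by rewrite /signed liftf_swap hdot_swap mulrN. Qed.

Definition sheet (i : bool) : set (regular R) :=
  [set x | 0 < (-1) ^+ i * signed (\val (repr (\val x)))].

Lemma sheetP i x p : represents p (\val x) ->
  sheet i x <-> 0 < (-1) ^+ i * signed p.
Proof.
move=> px; rewrite /sheet/=.
have [c] := represents_ratio px (represents_repr _).
rewrite Cs_unitE => /andP[c1 c2] ->; rewrite signed_scale mulrCA.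
by rewrite pmulr_rgt0 // exprn_even_gt0 //= mulf_neq0.
Qed.

Definition transverse : set (dS2 R) :=
  [set y | mink (\val (repr (\val y))) m != 0].

Lemma transverseP (y : dS2 R) n : represents n (\val y) ->
  transverse y <-> mink n m != 0.
Proof.
move=> ny; rewrite /transverse/=.
have [c] := represents_ratio ny (represents_repr _).
by rewrite unitfE => c0 ->; rewrite minkZl mulf_eq0 negb_or c0.
Qed.

Lemma open_transverse : open transverse.
Proof.
rewrite openE => y Uy; have ny := represents_repr (\val y).
set n := \val (repr (\val y)) in ny; apply: (nbhs_dS2 transverse ny).2.
have n0 : mink n m != 0 by apply/(transverseP ny).
have := @cvgr_neq0 _ _ _ _ (nbhs_filter n) _ _ (@mink_continuous _ n) n0.
by apply: filterS => v vm y' vy'; apply/(transverseP vy').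
Qed.

Lemma open_sheet i : open (sheet i).
Proof.
rewrite openE => x Vx; have px := represents_repr (\val x).
set p := \val (repr (\val x)) in px; apply: (nbhs_regular (sheet i) px).2.
have sp : 0 < (-1) ^+ i * signed p by apply/(sheetP _ px).
have sC : (-1) ^+ i * signed q @[q --> nbhs p] --> (-1) ^+ i * signed p.
  apply: cvgM; first exact: cvg_cst.
  apply: cvgM; last exact: hdot_continuous.
  apply: mink_cvg; exact: liftf_continuous.
have := @cvgr_gt _ _ _ (nbhs_filter p) _ _ sC _ sp.
by apply: filterS => q sq x' qx'; apply/(sheetP _ qx').
Qed.

Lemma trivIset_sheet : trivIset setT sheet.
Proof.
apply/trivIsetP => i j _ _ ij; apply/seteqP; split=> // x [].
have -> : i = ~~ j by case: i j ij => [] [].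
by rewrite /sheet /= signrN mulNr oppr_gt0 => /ltW; rewrite leNgt => /negP.
Qed.

Lemma preimage_transverse : cross_map @^-1` transverse = \bigcup_i sheet i.
Proof.
apply/seteqP; split=> x /=.
  have px := represents_repr (\val x) => /(transverseP (cross_mapP px)) lm.
  have : signed (\val (repr (\val x))) != 0.
    by rewrite mulf_neq0 // (regular_hdot px).
  rewrite neq_lt => /orP[s0|s0]; [exists true|exists false] => //; rewrite /sheet/=.
    by rewrite mulN1r oppr_gt0.
  by rewrite mul1r.
move=> [i _ xi]; have px := represents_repr (\val x).
apply/(transverseP (cross_mapP px)).
by apply: contraTneq xi => lm; rewrite /sheet /= /signed lm mul0r mulr0 ltxx.
Qed.

(** The two points of a fiber differ by the sign of hdot relative to liftf,
    which the sign of signed records. *)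
Lemma cross_map_sheet_inj i x y : sheet i x -> sheet i y ->
  cross_map x = cross_map y -> x = y.
Proof.
move=> xi yi.
have px := represents_repr (\val x); have qy := represents_repr (\val y).
move=> /(cross_map_fiber px qy)[c [lE [hE|hE]]].
  exact: liftf_hdot_inj px qy lE hE.
move: yi xi; rewrite /sheet/= {1}/signed lE hE minkZl.
set h := hdot _; set l := mink _ m; rewrite -/(signed _).
have -> : c * l * (- c * h) = - (c ^+ 2 * (l * h)) by ring.
rewrite mulrN oppr_gt0 mulrCA => /ltW + hp; rewrite leNgt => /negP.
have c0 : c != 0.
  by move: (regular_hdot qy); rewrite hE; apply: contraNneq => ->; rewrite oppr0 mul0r.
by case; rewrite mulr_gt0 // exprn_even_gt0.
Qed.

Lemma cross_map_sheet_surj i (y : dS2 R) : transverse y ->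
  exists x, sheet i x /\ cross_map x = y.
Proof.
move=> Uy; have [x xy] := cross_map_surj y.
have px := represents_repr (\val x).
have : (cross_map @^-1` transverse) x by rewrite /= xy.
rewrite preimage_transverse => -[j _ xj].
have [<-|ij] := eqVneq j i; first by exists x.
have [x' x'P] := swap_ex x; have px' := x'P _ px.
exists x'; split; last by rewrite (cross_map_swap px px').
apply/(sheetP _ px'); rewrite signed_swap.
move: xj; have -> : j = ~~ i by case: i j ij => [] [].
by rewrite /sheet /= signrN mulNr mulrN.
Qed.
End Sheets.

(** For n = liftf q and s = hdot q, the matrix with rows (s - n2, n1 + n0) and
    (n1 - n0, s + n2) is 2 (a, b)^T (a', b') for q. It is applied here to the
    row of p to recover the column (a, b) of q, and to the column of p to
    recover the row (a', b'); this is polynomial in n and s and does not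
    degenerate near p. *)
Definition lift_through p (s : R) (n : 'rV[R]_3) : 'rV[Cs]_2 :=
  let a := (p 0 0).1 in let a' := (p 0 0).2 in
  let b := (p 0 1).1 in let b' := (p 0 1).2 in
  cvec ((s - n 0 2) * a' + (n 0 1 + n 0 0) * b')
       (a * (s - n 0 2) + b * (n 0 1 - n 0 0))
       ((n 0 1 - n 0 0) * a' + (s + n 0 2) * b')
       (a * (n 0 1 + n 0 0) + b * (s + n 0 2)).

Definition lift_factor p (s : R) (n : 'rV[R]_3) : R :=
  2 * (s * hdot p +
       (n 0 0 * liftf p 0 0 + n 0 1 * liftf p 0 1 + n 0 2 * liftf p 0 2)).

(** For 2 x 2 matrices N X N = tr (X N) N - det N adj X, by the
    Cayley-Hamilton theorem for X N. Here N is the matrix of n and s, whose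
    determinant is s^2 - <n, n> = 0, X is the product of the row of p
    (as a column) by the column of p (as a row), and the entries of N X N are
    the products of the components of the lift. *)
Lemma lift_throughP p s n : mink n n = s ^+ 2 ->
  liftf (lift_through p s n) = lift_factor p s n *: n /\
  hdot (lift_through p s n) = lift_factor p s n * s.
Proof.
move=> ns; rewrite {1}/liftf {1}/hdot /lift_through !cvecE /=.
set a := (p 0 0).1; set a' := (p 0 0).2; set b := (p 0 1).1; set b' := (p 0 1).2.
set n0 := n 0 0; set n1 := n 0 1; set n2 := n 0 2.
set A := (s - n2) * a' + (n1 + n0) * b'; set A' := a * (s - n2) + b * (n1 - n0).
set B := (n1 - n0) * a' + (s + n2) * b'; set B' := a * (n1 + n0) + b * (s + n2).
set k := lift_factor p s n.
(* D is kept as a variable so that the identities below hold in the polynomial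
   ring; it vanishes by hypothesis. *)
pose D := s ^+ 2 - mink n n; have D0 : D = 0 by rewrite /D ns subrr.
have kE : k = 2 * (a * a' * (s - n2) + a * b' * (n1 + n0) + b * a' * (n1 - n0)
   + b * b' * (s + n2)).
  by rewrite /k /lift_factor /liftf /hdot !vec3E -/a -/b -/a' -/b' -/n0 -/n1 -/n2; ring.
have DE : D = s ^+ 2 + n0 ^+ 2 - n1 ^+ 2 - n2 ^+ 2.
  by rewrite /D /mink -/n0 -/n1 -/n2; ring.
have E1 : A * A' = k / 2 * (s - n2) - D * (b * b').
  by rewrite kE DE /A /A'; field.
have E2 : A * B' = k / 2 * (n1 + n0) + D * (a' * b).
  by rewrite kE DE /A /B'; field.
have E3 : A' * B = k / 2 * (n1 - n0) + D * (a * b').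
  by rewrite kE DE /A' /B; field.
have E4 : B * B' = k / 2 * (s + n2) - D * (a * a').
  by rewrite kE DE /B /B'; field.
rewrite {}D0 in E1 E2 E3 E4.
split; last by rewrite E1 E4; field.
apply: row3P; rewrite row3_scaleE vec3E -/n0 -/n1 -/n2 ?E1 ?E2 ?E3 ?E4; by field.
Qed.

Lemma lift_factor_gt0 p : hdot p != 0 ->
  0 < lift_factor p (hdot p) (liftf p).
Proof.
move=> h0; rewrite /lift_factor mulr_gt0 // -!expr2.
by rewrite ltr_pwDl ?exprn_even_gt0 // !addr_ge0 // ?sqr_ge0.
Qed.

Lemma lift_factorZ p s n t :
  lift_factor p (t * s) (t *: n) = t * lift_factor p s n.
Proof. by rewrite /lift_factor !row3_scaleE; ring. Qed.

Lemma lift_factor_cvg (U : Type) (F : set_system U) p (s : U -> R)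
    (h : U -> 'rV[R]_3) r n : Filter F ->
  s t @[t --> F] --> r -> h t @[t --> F] --> n ->
  lift_factor p (s t) (h t) @[t --> F] --> lift_factor p r n.
Proof.
move=> FF sr hn; have hi i : h t 0 i @[t --> F] --> n 0 i by exact: cvg_coord_rV.
apply: cvgM; first exact: cvg_cst.
apply: cvgD; first by apply: cvgM => //; exact: cvg_cst.
by do 2?apply: cvgD; apply: cvgM => //; exact: cvg_cst.
Qed.

Lemma lift_through_cvg (U : Type) (F : set_system U) p (s : U -> R)
    (h : U -> 'rV[R]_3) r n : Filter F ->
  s t @[t --> F] --> r -> h t @[t --> F] --> n ->
  lift_through p (s t) (h t) @[t --> F] --> lift_through p r n.
Proof.
move=> FF sr hn; have hi i : h t 0 i @[t --> F] --> n 0 i by exact: cvg_coord_rV.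
have c0 (c : R) : (fun=> c) @ F --> c by exact: cvg_cst.
have sm : s t - h t 0 2 @[t --> F] --> r - n 0 2 by exact: cvgB.
have sp : s t + h t 0 2 @[t --> F] --> r + n 0 2 by exact: cvgD.
have dp : h t 0 1 + h t 0 0 @[t --> F] --> n 0 1 + n 0 0 by exact: cvgD.
have dm : h t 0 1 - h t 0 0 @[t --> F] --> n 0 1 - n 0 0 by exact: cvgB.
by apply: cvec_cvg; apply: cvgD; exact: cvgM.
Qed.

Section LocalInverse.
Variables (m : 'rV[R]_3) (i : bool) (g : dS2 R -> regular R).
Hypothesis gP : forall y : dS2 R, transverse m y ->
  sheet m i (g y) /\ cross_map (g y) = y.

(** The representative of [n] with product 1 with m: like the height,
    it depends on [n] only, and continuously where <n, m> <> 0. *)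
Definition scaled n := (mink n m)^-1 *: n.
Definition height n := (-1) ^+ i * Num.sqrt (mink (scaled n) (scaled n)).

Lemma height_sqr n : 0 < mink n n -> mink n m != 0 ->
  mink (scaled n) (scaled n) = height n ^+ 2 /\ 0 < (-1) ^+ i * height n.
Proof.
move=> nn nm.
have snn : 0 < mink (scaled n) (scaled n).
  rewrite minkZl minkZr mulrA -expr2 pmulr_rgt0 // exprn_even_gt0 //=.
  by rewrite invr_eq0.
rewrite exprMn sqrr_sign mul1r sqr_sqrtr ?ltW //; split=> //.
by rewrite mulrA -expr2 sqrr_sign mul1r sqrtr_gt0.
Qed.

(** The lift lies in the right sheet over y, and so does g y; the sheet maps
    injectively. *)
Lemma local_inverseP p n (y : dS2 R) : represents n (\val y) -> transverse m y ->
  lift_factor p (height n) (scaled n) != 0 ->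
  represents (lift_through p (height n) (scaled n)) (\val (g y)).
Proof.
move=> ny Uy k0; have nm : mink n m != 0 by apply/(transverseP m ny).
have nn : 0 < mink n n by apply/(dS2P ny); exact: set_valP.
have [hh hi] := height_sqr nn nm.
have [lE hE] := lift_throughP p hh.
set q := lift_through _ _ _ in lE hE *; set k := lift_factor _ _ _ in k0 lE hE.
have hn0 : height n != 0 by apply: contraTneq hi => ->; rewrite mulr0 ltxx.
have [x qx] : exists x, represents q (\val x).
  by apply: regular_ex; rewrite hE mulf_neq0.
have [gi gy] := gP Uy.
suff -> : g y = x by [].
apply: (@cross_map_sheet_inj m i) => //.
  apply/(sheetP _ _ qx); rewrite /signed lE hE !minkZl mulVf // mulr1.
  have -> : (-1) ^+ i * (k * (k * height n)) = k ^+ 2 * ((-1) ^+ i * height n).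
    by ring.
  by rewrite mulr_gt0 // exprn_even_gt0.
rewrite gy; apply: val_inj; apply: represents_inj (cross_mapP qx).
rewrite lE scalerA; apply: represents_scaleR => //.
by rewrite mulf_neq0 // invr_eq0.
Qed.

(** Near y the explicit lifts through a representative p of g y represent g,
    and they are continuous; at y the nondegeneracy factor is a nonzero
    multiple of the positive number of lift_factor_gt0. *)
Lemma local_inverse_cvg (y : dS2 R) : transverse m y -> g z @[z --> y] --> g y.
Proof.
move=> Uy N; have [Vx xy] := gP Uy.
have px := represents_repr (\val (g y)).
set p := \val (repr (\val (g y))) in px.
have h0 := regular_hdot px.
have ny := cross_mapP px; rewrite xy in ny.
set n := liftf p in ny.
have nm : mink n m != 0 by apply/(transverseP m ny).
have sp : 0 < (-1) ^+ i * signed m p by apply/(sheetP _ _ px).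
(* The sign of the sheet selects the root that gives back p. *)
have hn : height n = (mink n m)^-1 * hdot p.
  have E : (mink n m)^-1 * hdot p = (mink n m)^-1 ^+ 2 * signed m p.
    by rewrite /signed -/n; field.
  rewrite /height minkZl minkZr mink_liftf mulrA -expr2 -exprMn sqrtr_sqr E.
  rewrite normrM normrX real_normK ?num_real // mulrCA; congr (_ * _).
  case: (i) sp; rewrite /= ?mul1r ?mulN1r => sp.
    by rewrite ltr0_norm ?opprK // -oppr_gt0.
  by rewrite gtr0_norm.
have k0 : lift_factor p (height n) (scaled n) != 0.
  rewrite hn lift_factorZ mulf_neq0 ?invr_eq0 //.
  by rewrite gt_eqF // lift_factor_gt0.
have Fn := nbhs_filter n.
have scaled_cvg : scaled v @[v --> nbhs n] --> scaled n.
  apply: cvg_rV => j; rewrite row3_scaleE.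
  under [X in X @ _]eq_fun do rewrite row3_scaleE.
  apply: cvgM; last exact: coord_rV_continuous.
  by apply: cvgV => //; exact: mink_continuous.
have height_cvg : height v @[v --> nbhs n] --> height n.
  apply: cvgM; first exact: cvg_cst.
  have S := mink_cvg2 Fn scaled_cvg scaled_cvg.
  exact: (cvg_comp _ Num.sqrt S (@sqrt_continuous R _)).
move=> /(nbhs_regular _ (local_inverseP ny Uy k0)) Np.
apply: (nbhs_dS2 (g @^-1` N) ny).2.
have factor_cvg := lift_factor_cvg (p := p) Fn height_cvg scaled_cvg.
have near_k := @cvgr_neq0 _ _ _ _ Fn _ _ factor_cvg k0.
have near_m := @cvgr_neq0 _ _ _ _ Fn _ _ (@mink_continuous m n) nm.
have near_N := lift_through_cvg (p := p) Fn height_cvg scaled_cvg Np.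
apply: filterS3 near_k near_m near_N => v vk vm vN y' vy'.
by apply: vN; apply: local_inverseP => //; apply/(transverseP m vy').
Qed.
End LocalInverse.

Lemma covering_cross_map : covering_map cross_map.
Proof.
split; first exact: cross_map_continuous.
move=> y; have [x0 x0y] := cross_map_surj y.
have px := represents_repr (\val x0); set p := \val (repr (\val x0)) in px.
have ly := cross_mapP px; rewrite x0y in ly.
exists (transverse (liftf p)); split; first exact: open_transverse.
  by apply/(transverseP _ ly); rewrite gt_eqF // liftf_gt0 // (regular_hdot px).
exists bool, (sheet (liftf p)); split.
- exact: open_sheet.
- exact: trivIset_sheet.
- exact: preimage_transverse.
move=> i.
have exg (z : dS2 R) : exists x, transverse (liftf p) z ->
    sheet (liftf p) i x /\ cross_map x = z.
  have [Uz|nUz] := pselect (transverse (liftf p) z); last by exists x0.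
  by have [x xP] := cross_map_sheet_surj i Uz; exists x.
have [g gP] := choice exg.
have toU x : sheet (liftf p) i x -> transverse (liftf p) (cross_map x).
  move=> xi; have : (\bigcup_i sheet (liftf p) i) x by exists i.
  by rewrite -preimage_transverse.
split.
  split.
  - exact: toU.
  - by move=> x x'; rewrite !inE; exact: cross_map_sheet_inj.
  - by move=> z /gP[zi zz]; exists (g z).
exists g; split.
- move=> x xi; have [gi gx] := gP _ (toU _ xi).
  exact: cross_map_sheet_inj gi xi gx.
- by apply: continuous_subspaceT; exact: cross_map_continuous.
- rewrite continuous_open_subspace; last exact: open_transverse.
  by move=> z; rewrite inE; exact: (@local_inverse_cvg (liftf p) i g gP z).
Qed.

(** * The differential and the metrics *)
Lemma Cs_invE (c : Cs) : c.1 != 0 -> c.2 != 0 -> c^-1 = (c.1^-1, c.2^-1).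
Proof.
move=> c1 c2; have cu : c \is a GRing.unit by rewrite Cs_unitE c1.
apply: (mulrI cu); rewrite divrr //; apply: injective_projections => /=;
  by rewrite divff.
Qed.

(** The derivative at p of the quadratic map liftf. *)
Definition dliftf p (u : 'rV[Cs]_2) : 'rV[R]_3 :=
  let a := (p 0 0).1 in let a' := (p 0 0).2 in
  let b := (p 0 1).1 in let b' := (p 0 1).2 in
  let da := (u 0 0).1 in let da' := (u 0 0).2 in
  let db := (u 0 1).1 in let db' := (u 0 1).2 in
  vec3 (da * b' + a * db' - (da' * b + a' * db))
       (da * b' + a * db' + (da' * b + a' * db))
       (- (da * a' + a * da') + (db * b' + b * db')).

Lemma dliftfD p (u v : 'rV[Cs]_2) : dliftf p (u + v) = dliftf p u + dliftf p v.
Proof.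
by apply: row3P; rewrite /dliftf [RHS]mxE !vec3E !mxE /=; ring.
Qed.

Lemma dliftfZ p (r : R) (u : 'rV[Cs]_2) :
  dliftf p (((r, r) : Cs) *: u) = r *: dliftf p u.
Proof.
by apply: row3P; rewrite /dliftf row3_scaleE !vec3E !fst_scale !snd_scale /=; ring.
Qed.

Lemma dliftf_line p (c : Cs) : dliftf p (c *: p) = (c.1 + c.2) *: liftf p.
Proof.
by apply: row3P; rewrite /dliftf /liftf row3_scaleE !vec3E !fst_scale !snd_scale; ring.
Qed.

Lemma dliftf_scale p (u : 'rV[Cs]_2) (c : Cs) :
  dliftf (c *: p) (c *: u) = (c.1 * c.2) *: dliftf p u.
Proof.
by apply: row3P; rewrite /dliftf row3_scaleE !vec3E !fst_scale !snd_scale; ring.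
Qed.

(** The equation <u, p> = 0 consists of two real linear equations, one for
    each of the pairs of first and of second components of u. *)
Lemma herm_orth p (u : 'rV[Cs]_2) : hdot p != 0 -> herm u p = 0 ->
  exists l l', u = cvec (- l * (p 0 1).2) (- l' * (p 0 1).1)
                        (l * (p 0 0).2) (l' * (p 0 0).1).
Proof.
move=> h0 up; have := congr1 snd up; have := congr1 fst up.
rewrite /herm /conjs !CsE /=.
have := hdot_good h0; rewrite {1}(cvec_eta p) => /good_cvec[pg pg'] up1 up2.
have [l [l0 l1]] : exists l, - (u 0 0).1 = l * (p 0 1).2 /\ (u 0 1).1 = l * (p 0 0).2.
  apply: proportional2; first by rewrite addrC.
  by rewrite mulrN; apply/eqP; rewrite -addr_eq0; apply/eqP; lra.
have [l' [l0' l1']] : exists l, - (u 0 0).2 = l * (p 0 1).1 /\ (u 0 1).2 = l * (p 0 0).1.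
  apply: proportional2; first by rewrite addrC.
  by rewrite mulrN; apply/eqP; rewrite -addr_eq0; apply/eqP; lra.
exists l, l'; rewrite !mulNr -l0 -l0' -l1 -l1' !opprK; exact: cvec_eta.
Qed.

Lemma dliftf_orth p l l' :
  dliftf p (cvec (- l * (p 0 1).2) (- l' * (p 0 1).1)
                 (l * (p 0 0).2) (l' * (p 0 0).1))
  = l' *: endA p - l *: endB p.
Proof.
by apply: row3P; rewrite /dliftf [RHS]mxE [in RHS]mxE !cvecE !mxE /=; ring.
Qed.

Lemma mink_ends_liftf p : mink (endA p) (liftf p) = 0 /\ mink (endB p) (liftf p) = 0.
Proof. by split; rewrite /mink /endA /endB /liftf !vec3E; ring. Qed.

(** With u and v given by (k, k') and (l, l'), the derivatives are
    k' A - k B and l' A - l B, so the left side is - 2 (k' l + k l'); on the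
    right <u, v> has components k l' h and k' l h. *)
Lemma mink_dliftf p (u v : 'rV[Cs]_2) :
  hdot p != 0 -> herm u p = 0 -> herm v p = 0 ->
  - (mink (dliftf p u) (dliftf p v) / hdot p ^+ 2) =
  - 4 * Res (herm u v / herm p p).
Proof.
move=> h0 /(herm_orth h0)[k [k' ->]] /(herm_orth h0)[l [l' ->]].
rewrite !dliftf_orth !minkE endA_null endB_null (minkC (endB p)) mink_ends.
rewrite hermE Cs_invE // /Res /herm /conjs !cvecE !CsE /=.
have -> : k' * (l' * 0) - k' * (l * - (2 * hdot p ^+ 2)) -
  (k * (l' * - (2 * hdot p ^+ 2)) - k * (l * 0)) =
  2 * (k' * l + k * l') * hdot p ^+ 2 by ring.
rewrite mulfK ?expf_neq0 //.
set a := (p 0 0).1; set a' := (p 0 0).2; set b := (p 0 1).1; set b' := (p 0 1).2.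
have hE : hdot p = a * a' + b * b' by [].
by rewrite hE; field; rewrite -hE.
Qed.

Lemma is_derive_pair (F : R -> Cs) (v : Cs) (x : R) : is_derive x 1 F v ->
  is_derive x 1 (fun e => (F e).1) v.1 /\ is_derive x 1 (fun e => (F e).2) v.2.
Proof.
move=> [dF Fv]; have := dF; rewrite /derivable => /cvg_ex[l Fl].
have lv : l = v by rewrite -Fv; apply/esym/cvg_lim.
rewrite {}lv in Fl.
have F1 : h^-1 *: (((fun e => (F e).1) \o shift x) (h *: 1) - (F x).1)
    @[h --> 0^'] --> v.1.
  by move=> N Nv; apply: (Fl (fst @^-1` N)); exact: (@cvg_fst _ _ _ (nbhs v.2) _ N Nv).
have F2 : h^-1 *: (((fun e => (F e).2) \o shift x) (h *: 1) - (F x).2)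
    @[h --> 0^'] --> v.2.
  by move=> N Nv; apply: (Fl (snd @^-1` N)); exact: (@cvg_snd _ _ (nbhs v.1) _ _ N Nv).
by split; apply: DeriveDef;
  [exact: cvgP F1|exact: cvg_lim F1|exact: cvgP F2|exact: cvg_lim F2].
Qed.

Lemma is_derive_row (M : R -> 'rV[R]_3) (w : 'rV[R]_3) (x : R) :
  (forall i, is_derive x 1 (fun e => M e 0 i) (w 0 i)) -> is_derive x 1 M w.
Proof.
move=> dM; have dM' : derivable M x 1.
  by apply/derivable_mxP => i j; rewrite ord1; have [] := dM j.
apply: DeriveDef => //; rewrite derive_mx //; apply/rowP => j; rewrite mxE.
by have [_ ->] := dM j.
Qed.

Lemma is_derive_liftf (gamma : R -> 'rV[Cs]_2) (v : 'rV[Cs]_2) (x : R) :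
  (forall i, is_derive x (1 : R) (fun e => gamma e 0 i : Cs) (v 0 i)) ->
  is_derive x (1 : R) (fun e => liftf (gamma e)) (dliftf (gamma x) v).
Proof.
move=> dg; have [da da'] := is_derive_pair (dg 0).
have [db db'] := is_derive_pair (dg 1).
apply: is_derive_row => i.
have dab' := is_deriveM da db'. have da'b := is_deriveM da' db.
have daa' := is_deriveM da da'. have dbb' := is_deriveM db db'.
case: i => -[|[|[|//]]] ?; rewrite /liftf /dliftf;
  under eq_fun do rewrite mxE /=; rewrite mxE /=.
- apply: is_derive_eq (is_deriveB dab' da'b) _.
  by rewrite /GRing.scale /=; ring.
- apply: is_derive_eq (is_deriveD dab' da'b) _.
  by rewrite /GRing.scale /=; ring.
- apply: is_derive_eq (is_deriveD (is_deriveN daa') dbb') _.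
  by rewrite /GRing.scale /=; ring.
Qed.

Lemma mink_dliftf_liftf p (u : 'rV[Cs]_2) : hdot p != 0 -> herm u p = 0 ->
  mink (dliftf p u) (liftf p) = 0.
Proof.
move=> h0 /(herm_orth h0)[l [l' ->]]; have [A0 B0] := mink_ends_liftf p.
by rewrite dliftf_orth !minkE A0 B0 !mulr0 subrr.
Qed.

Section TangentVector.
Variables (y : P2 R) (n w : 'rV[R]_3).
Hypotheses (ny : represents n y) (wn : mink w n = 0).

(** On the line spanned by n, the linear map sending n to w. *)
Definition scaled_vector (v : line_type y) : 'rV[R]_3 :=
  (mink v n / mink n n) *: w.

Lemma scaled_vector_linear : linear scaled_vector.
Proof.
move=> a u v; rewrite /scaled_vector scalerA -scalerDl; congr (_ *: _).
by rewrite mulrA -mulrDl -minkZl -minkDl.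
Qed.

HB.instance Definition _ := GRing.isLinear.Build R (line_type y) 'rV[R]_3 *:%R
  scaled_vector scaled_vector_linear.

Lemma scaled_vector_perp (u v : line_type y) : mink (scaled_vector u) v = 0.
Proof.
have /asboolP[c ->] := line_valP v.
have [d _ ->] := represents_ratio ny (represents_repr y).
by rewrite /scaled_vector !minkE wn !mulr0.
Qed.

Definition tangent_vector : T2 y :=
  @Tangent _ _ _ _ _ scaled_vector scaled_vector_perp.
End TangentVector.

Section Differential.
Variable x : regular R.
Let p0 : 'rV[Cs]_2 := \val (repr (\val x)).
Let p0x : represents p0 (\val x) := represents_repr (\val x).
Let h0 : hdot p0 != 0 := regular_hdot p0x.
Let p0l : line_type (\val x) := LinePoint (represents_line p0x).

Lemma tangent_scale (phi : T1 (\val x)) (p : line_type (\val x)) (c : Cs) :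
  \val p = c *: p0 -> phi p = c *: phi p0l.
Proof.
move=> pE; rewrite -linearZ; congr (phi _); exact: val_inj.
Qed.

Lemma tangent_herm (phi : T1 (\val x)) : herm (phi p0l) p0 = 0.
Proof. exact: (tangent_perp phi p0l p0l). Qed.

Definition differential (phi : T1 (\val x)) : T2 (\val (cross_map x)) :=
  tangent_vector (cross_mapP p0x)
    (mink_dliftf_liftf h0 (tangent_herm phi)).

(** A rescaling p |-> d p multiplies both liftf p and dliftf p (phi p) by
    d.1 d.2, so any representative computes the differential. *)
Lemma differentialE (phi : T1 (\val x)) (p : line_type (\val x))
    (q : line_type (\val (cross_map x))) c :
  \val q = c *: liftf p -> represents p (\val x) ->
  differential phi q = c *: dliftf p (phi p).
Proof.
move=> qE px; have [d _ pE] := represents_ratio p0x px.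
rewrite (tangent_scale phi pE) pE dliftf_scale /differential /tangent_vector /=.
rewrite /scaled_vector; have -> : line_val q = c *: liftf p by [].
rewrite pE liftf_scale !minkZl !mulrA mulfK; last by rewrite mink_liftf expf_neq0.
by rewrite scalerA mulrA.
Qed.

Lemma differential_linear (r : R) (phi psi chi : T1 (\val x)) :
  (forall u : line_type (\val x), chi u = ((r, r) : Cs) *: phi u + psi u) ->
  forall v : line_type (\val (cross_map x)),
    differential chi v = r *: differential phi v + differential psi v.
Proof.
move=> chiE v; rewrite /differential /= /scaled_vector chiE.
by rewrite dliftfD dliftfZ scalerDr !scalerA mulrC.
Qed.

(** The lift liftf o gamma has derivative dliftf p v, where v is phi p plus a
    multiple of p; the latter contributes a multiple of liftf p, which does
    not change the velocity. *)
Lemma differential_velocity (c : R -> regular R) (phi : T1 (\val x)) :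
  velocity1 (fun e => \val (c e)) phi ->
  velocity2 (fun e => \val (cross_map (c e))) (differential phi).
Proof.
move=> [c0 [gamma [v [p [g0 gc dg vphi]]]]].
have c0x : c 0 = x by exact: val_inj.
have px : represents p (\val x).
  by rewrite -g0 -c0; exact: (nbhs_singleton gc).
have qx := cross_mapP px.
split; first by rewrite c0x.
exists (fun e => liftf (gamma e)), (dliftf p v), (LinePoint (represents_line qx)).
split; first by rewrite /= g0.
- by apply: filterS gc => e; exact: cross_mapP.
- by rewrite -g0; exact: is_derive_liftf.
- have [d vE] := (lineP _ px).1 vphi.
  rewrite (@differentialE phi p _ 1) //; last by rewrite scale1r.
  rewrite scale1r.
  have -> : v = d *: (p : 'rV[Cs]_2) + phi p by rewrite -vE subrK.
  rewrite dliftfD addrK dliftf_line.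
  by apply/(lineP _ qx); eexists.
Qed.

Lemma differential_metric (phi psi : T1 (\val x)) (p : line_type (\val x))
    (q : line_type (\val (cross_map x))) :
  represents p (\val x) -> represents q (\val (cross_map x)) ->
  gdS2 q (differential phi) (differential psi) = - 4 * gP1 p phi psi.
Proof.
move=> px qx; have [c] := represents_ratio (cross_mapP px) qx.
rewrite unitfE => c0 qE; rewrite /gdS2 /gP1.
rewrite (@differentialE phi p q c) // (@differentialE psi p q c) // qE !minkE mink_liftf.
rewrite -(mink_dliftf (regular_hdot px)); try exact: tangent_perp.
by field; rewrite c0 (regular_hdot px).
Qed.

Lemma is_differential_differential : is_differential differential.
Proof.
split; [exact: differential_linear|exact: differential_velocity].
Qed.
End Differential.
End SplitComplex.
End MinkowskiSpace.

Theorem mainTheorem2 (R : realType) :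
  (exists G : regular R -> oriented_geodesic R,
     (forall (x : regular R) p, represents p (\val x) ->
        exists alpha beta : P2 R,
          [/\ represents (endA p) alpha, represents (endB p) beta,
              bdH2 alpha, bdH2 beta &
              forall g : oriented_geodesic R,
                goes_from_to g beta alpha <-> g = G x]) /\
     bijective G) /\
  (exists f : regular R -> dS2 R,
     [/\ forall (x : regular R) p, represents p (\val x) ->
           represents (cross (endA p) (endB p)) (\val (f x)) /\
           represents (liftf p) (\val (f x)),
         covering_map f,
         two_to_one f &
         forall x : regular R,
           exists df : T1 (\val x) -> T2 (\val (f x)),
             is_differential df /\
             forall (phi psi : T1 (\val x))
                    (p : line_type (\val x)) (q : line_type (\val (f x))),
               represents p (\val x) -> represents q (\val (f x)) ->
               gdS2 q (df phi) (df psi) = - 4 * gP1 p phi psi]).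
Proof.
split.
  exists regular_geodesic; split; last exact: regular_geodesic_bij.
  exact: regular_geodesicP.
exists cross_map; split.
- move=> x p px; split; last exact: cross_mapP.
  rewrite cross_ends; apply: represents_scaleR; last exact: cross_mapP.
  by rewrite mulf_neq0 ?pnatr_eq0 ?(regular_hdot px).
- exact: covering_cross_map.
- exact: two_to_one_cross_map.
- move=> x; exists (differential (x := x)).
  split; first exact: is_differential_differential.
  exact: differential_metric.
Qed.
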